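(* Consider system (5) in the standing setup with fixed $\sigma$ and weights, and suppose that the joint follower graph $\mathcal G^F([0,+\infty))$ is acyclic (contains no directed cycle). Then system (5) is SiISS with respect to $\mathcal L(y(t))$ if and only if $\mathcal G_{\sigma(t)}$ is jointly L-connected (JLC).
   Context: Standing setup. Fix integers $n\ge 2$, $k\ge 1$, $d\ge 1$. The follower set is $\mathcal V_F=\{1,\dots,n\}$ and the leader set is $\mathcal V_L=\{\hat 1,\dots,\hat k\}$ (disjoint from $\mathcal V_F$); $\mathcal V=\mathcal V_F\cup\mathcal V_L$. The interaction topology is a time-varying digraph $\mathcal G_{\sigma(t)}=(\mathcal V,\mathcal E_{\sigma(t)})$, where $\sigma:[0,\infty)\to\mathcal P$ is a piecewise constant switching signal taking values in a finite set $\mathcal P$ of digraphs on $\mathcal V$; no arc of any of these digraphs enters a leader. An arc $(j,i)$ means that $i$ receives information from $j$. Dwell-time assumption: any two consecutive switching instants of $\sigma$ are separated by at least $\tau_D>0$. For $i\in\mathcal V_F$, $N_i(\sigma(t))=\{j\in\mathcal V_F:(j,i)\in\mathcal E_{\sigma(t)}\}$ and $L_i(\sigma(t))=\{j\in\mathcal V_L:(j,i)\in\mathcal E_{\sigma(t)}\}$. $\mathcal G^F_{\sigma(t)}$ denotes the subgraph of $\mathcal G_{\sigma(t)}$ induced on $\mathcal V_F$. For $0\le t_1<t_2\le\infty$ the joint graph is $\mathcal G([t_1,t_2))=(\mathcal V,\bigcup_{t\in[t_1,t_2)}\mathcal E_{\sigma(t)})$, and $\mathcal G^F([t_1,t_2))$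 is its subgraph induced on $\mathcal V_F$. System (5): $\dot y_i=u_i(y,t)$ for $i=1,\dots,k$, and $\dot x_i=\sum_{j\in N_i(\sigma(t))}a_{ij}(x,y,t)(x_j-x_i)+\sum_{j\in L_i(\sigma(t))}b_{ij}(x,y,t)(y_j-x_i)+w_i(t)$ for $i=1,\dots,n$, where $x_i,y_j\in\mathbb R^d$, $x=(x_1,\dots,x_n)$, $y=(y_1,\dots,y_k)$; each $u_i(y,t)$ is continuous in $y$ and piecewise continuous in $t$; each $w_i$ is continuous; the weights $a_{ij},b_{ij}$ are continuous and satisfy $a_*\le a_{ij}(x,y,t)\le a^*$, $b_{ij}(x,y,t)\ge b_*$ for all $x,y,t$, with constants $0<a_*\le a^*$, $b_*>0$. Initial time is $0$, $x^0=x(0)$, $y^0=y(0)$. Along a trajectory, $z(t)=(u_1(y(t),t),\dots,u_k(y(t),t),w_1(t),\dots,w_n(t))\in\mathbb R^{(n+k)d}$ and $\|z\|_\infty=\sup_{t\ge0}|z(t)|$. Set notation: $|\cdot|$ is the Euclidean norm; for a closed convex $K\subset\mathbb R^d$, $|v|_K=\inf_{p\in K}|v-p|$; $\mathcal L(y(t))=\mathrm{co}\{y_1(t),\dots,y_k(t)\}$ (convex hull); $|x(t)|_{\mathcal L(y(t))}=\max_{i\in\mathcal V_F}|x_i(t)|_{\mathcal L(y(t))}$. Connectivity: a digraph on $\mathcal V$ is L-connected if for every $i\in\mathcal V_F$ there is a directed path from some leader $j\in\mathcal V_L$ to $i$. $\mathcal G_{\sigma(t)}$ is jointly L-connected (JLC)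 if $\mathcal G([t,\infty))$ is L-connected for every $t\ge0$; it is uniformly jointly L-connected (UJLC) if there is $T>0$ such that $\mathcal G([t,t+T))$ is L-connected for every $t\ge0$. SiISS: system (5) is (globally, generalized) set integral-input-to-state stable with respect to $\mathcal L(y(t))$ if there exist a class-$\mathcal{KL}$ function $\beta$ and a class-$\mathcal K$ function $\gamma$ such that for all admissible $u_i,w_i$ and all initial conditions $x^0\in\mathbb R^{nd}$, $y^0\in\mathbb R^{kd}$: $|x(t)|_{\mathcal L(y(t))}\le\beta(|x^0|_{\mathcal L(y^0)},t)+\int_0^t\gamma(|z(s)|)\,ds$ for all $t\ge0$. *)

(* Defs.v *)
From Stdlib Require Import Reals Lra Lia List Relations ClassicalEpsilon.
Open Scope R_scope.

(* Indexing conventions: followers are 0..n-1, leaders are 0..k-1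
   (two disjoint index sets), coordinates of R^d are 0..d-1.
   A stacked state (x_1,...,x_n) in R^{nd} is a function agent -> coord -> R;
   only in-range indices are meaningful. *)
Definition State := nat -> nat -> R.
Definition Vec := nat -> R.

Fixpoint sumR (m : nat) (f : nat -> R) : R :=
  match m with O => 0 | S m' => sumR m' f + f m' end.

Definition norm_d (d : nat) (v : Vec) : R := sqrt (sumR d (fun c => (v c)^2)).

Definition in_hull (k d : nat) (y : State) (p : Vec) : Prop :=
  exists lam : nat -> R,
    (forall j, (j < k)%nat -> 0 <= lam j) /\ sumR k lam = 1 /\
    forall c, (c < d)%nat -> p c = sumR k (fun j => lam j * y j c).

Definition is_inf (S : R -> Prop) (r : R) : Prop :=
  (forall s, S s -> r <= s) /\ (forall b, (forall s, S s -> b <= s) -> b <= r).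

Definition hull_dist (k d : nat) (y : State) (v : Vec) : R :=
  epsilon (inhabits 0)
    (is_inf (fun s => exists p, in_hull k d y p /\ s = norm_d d (fun c => v c - p c))).

Definition dist_max (n k d : nat) (y x : State) : R :=
  fold_right Rmax 0 (map (fun i => hull_dist k d y (x i)) (seq 0 n)).

(* ---- switching topology ----
   NF t j i = true  iff (j,i) is an arc of G_sigma(t) with j, i followers;
   NL t j i = true  iff (j,i) is an arc of G_sigma(t) with j leader, i follower.
   (No arc enters a leader, so this describes the whole digraph.) *)

Definition dwell_switching (NF NL : R -> nat -> nat -> bool) : Prop :=
  exists tauD : R, 0 < tauD /\
  exists s : nat -> R, s O = 0 /\ (forall m, s m + tauD <= s (S m)) /\
    forall m t, s m <= t < s (S m) ->
      (forall j i, NF t j i = NF (s m) j i) /\ (forall j i, NL t j i = NL (s m) j i).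

Definition joint_F (n : nat) (NF : R -> nat -> nat -> bool) (t0 : R) : relation nat :=
  fun j i => (j < n)%nat /\ (i < n)%nat /\ exists s, t0 <= s /\ NF s j i = true.

Definition joint_follower_acyclic (n : nat) (NF : R -> nat -> nat -> bool) : Prop :=
  forall i, (i < n)%nat -> ~ clos_trans nat (joint_F n NF 0) i i.

Definition L_connected_from (n k : nat) (NF NL : R -> nat -> nat -> bool) (t0 : R) : Prop :=
  forall i, (i < n)%nat ->
    exists l j, (l < k)%nat /\ (j < n)%nat /\
      (exists s, t0 <= s /\ NL s l j = true) /\
      clos_refl_trans nat (joint_F n NF t0) j i.

Definition JLC (n k : nat) (NF NL : R -> nat -> nat -> bool) : Prop :=
  forall t, 0 <= t -> L_connected_from n k NF NL t.

Definition close (m d : nat) (delta : R) (x x' : State) : Prop :=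
  forall i c, (i < m)%nat -> (c < d)%nat -> Rabs (x' i c - x i c) < delta.

Definition cont_xyt (n k d : nat) (f : State -> State -> R -> R) : Prop :=
  forall x y t eps, 0 < eps -> exists delta, 0 < delta /\
    forall x' y' t', close n d delta x x' -> close k d delta y y' -> Rabs (t' - t) < delta ->
      Rabs (f x' y' t' - f x y t) < eps.

Definition weights_ok (n k d : nat)
  (a : nat -> nat -> State -> State -> R -> R) (b : nat -> nat -> State -> State -> R -> R)
  (alo ahi blo : R) : Prop :=
  0 < alo /\ alo <= ahi /\ 0 < blo /\
  (forall i j, (i < n)%nat -> (j < n)%nat ->
     cont_xyt n k d (a i j) /\ forall x y t, alo <= a i j x y t <= ahi) /\
  (forall i j, (i < n)%nat -> (j < k)%nat ->
     cont_xyt n k d (b i j) /\ forall x y t, blo <= b i j x y t).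

Definition cont_y (k d : nat) (g : State -> Vec) : Prop :=
  forall y eps, 0 < eps -> exists delta, 0 < delta /\
    forall y', close k d delta y y' -> forall c, (c < d)%nat -> Rabs (g y' c - g y c) < eps.

(* piecewise continuous: on every compact interval, finitely many pieces, on each
   open piece the function agrees with a continuous function (so it has finite
   one-sided limits at the break points) *)
Definition pw_cont (f : R -> R) : Prop :=
  forall lo hi, lo < hi -> exists (m : nat) (p : nat -> R),
    p O = lo /\ p m = hi /\ (forall j, (j < m)%nat -> p j < p (S j)) /\
    forall j, (j < m)%nat -> exists g, continuity g /\
      forall t, p j < t < p (S j) -> f t = g t.

Definition admissible (n k d : nat) (u : nat -> State -> R -> Vec) (w : nat -> R -> Vec) : Prop :=
  (forall l t, (l < k)%nat -> cont_y k d (fun y => u l y t)) /\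
  (forall l y c, (l < k)%nat -> (c < d)%nat -> pw_cont (fun t => u l y t c)) /\
  (forall i c, (i < n)%nat -> (c < d)%nat -> continuity (fun t => w i t c)).

Definition rhsF (n k : nat) (NF NL : R -> nat -> nat -> bool)
  (a b : nat -> nat -> State -> State -> R -> R) (w : nat -> R -> Vec)
  (x y : R -> State) (s : R) (i c : nat) : R :=
  sumR n (fun j => if NF s j i then a i j (x s) (y s) s * (x s j c - x s i c) else 0)
  + sumR k (fun j => if NL s j i then b i j (x s) (y s) s * (y s j c - x s i c) else 0)
  + w i s c.

Definition solves (n k d : nat) (NF NL : R -> nat -> nat -> bool)
  (a b : nat -> nat -> State -> State -> R -> R)
  (u : nat -> State -> R -> Vec) (w : nat -> R -> Vec) (T : R) (x y : R -> State) : Prop :=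
  forall t, 0 <= t < T ->
    (forall l c, (l < k)%nat -> (c < d)%nat ->
       exists pr : Riemann_integrable (fun s => u l (y s) s c) 0 t,
         y t l c = y 0 l c + RiemannInt pr) /\
    (forall i c, (i < n)%nat -> (c < d)%nat ->
       exists pr : Riemann_integrable (fun s => rhsF n k NF NL a b w x y s i c) 0 t,
         x t i c = x 0 i c + RiemannInt pr).

Definition znorm (n k d : nat) (u : nat -> State -> R -> Vec) (w : nat -> R -> Vec)
  (y : R -> State) (s : R) : R :=
  sqrt (sumR k (fun l => sumR d (fun c => (u l (y s) s c)^2))
        + sumR n (fun i => sumR d (fun c => (w i s c)^2))).

Definition classK (g : R -> R) : Prop :=
  g 0 = 0 /\
  (forall r eps, 0 <= r -> 0 < eps -> exists delta, 0 < delta /\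
     forall r', 0 <= r' -> Rabs (r' - r) < delta -> Rabs (g r' - g r) < eps) /\
  (forall r s, 0 <= r -> r < s -> g r < g s).

Definition classKL (beta : R -> R -> R) : Prop :=
  (forall t, 0 <= t -> classK (fun r => beta r t)) /\
  (forall r, 0 <= r ->
     (forall t1 t2, 0 <= t1 -> t1 <= t2 -> beta r t2 <= beta r t1) /\
     (forall eps, 0 < eps -> exists T, forall t, T <= t -> beta r t < eps)).

Definition SiISS (n k d : nat) (NF NL : R -> nat -> nat -> bool)
  (a b : nat -> nat -> State -> State -> R -> R) : Prop :=
  exists beta gamma, classKL beta /\ classK gamma /\
    forall u w, admissible n k d u w ->
    forall T x y, 0 < T -> solves n k d NF NL a b u w T x y ->
    forall t, 0 <= t < T ->
    forall pr : Riemann_integrable (fun s => gamma (znorm n k d u w y s)) 0 t,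
      dist_max n k d (y t) (x t) <= beta (dist_max n k d (y 0) (x 0)) t + RiemannInt pr.

(* Main.v *)
From Coquelicot Require Import Coquelicot.
Require Import Defs.
From Stdlib Require Import Reals Lra Lia List Relations ClassicalEpsilon Classical FunctionalExtensionality.
Open Scope R_scope.

(* JLC => SiISS.  Let h_i be the distance of follower i to the leader hull and N(t) the
   integral of 2|z|.  Since the distance to a convex set is convex, h_i satisfies
   h_i' <= sum_j a_ij (h_j - h_i) - sum_j b_ij h_i + 2|z| in the sense of upper right Dini
   derivatives.  If all in-neighbours obey h_j <= m + N, then the positive part of
   h_i - N - m never increases, and it decays at rate at least min(alo, blo) whenever some
   arc enters i.  By JLC and the dwell time arcs enter i during infinitely many
   intervals of length tau_D, so induction along the acyclic follower graph gives, for each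
   eps, a time depending only on sigma after which h_i <= eps max_j h_j(0) + N.

   SiISS => JLC.  If some follower is not reachable from the leaders after a switching
   instant t0, put all leaders at rest at the origin and start all followers at the first
   basis vector.  Up to t0 the followers stay at a positive distance D from the origin, D
   depending only on the leader weights on [0, t0]; afterwards the followers from which the
   given one is reachable only average among themselves.  The weights are merely
   continuous, so instead of an exact solution one takes an Euler approximation and regards
   its error as the noise w, which can be made uniformly small on any [0, T].  The noise
   must be continuous although the vector field jumps at switching instants; hence each
   Euler step starts with the error left by the previous one and damps it linearly to 0. *)

(** * Finite sums, the Euclidean norm and the distance to the leader hull *)

Lemma sumR_ext m f g : (forall j, (j < m)%nat -> f j = g j) -> sumR m f = sumR m g.
Proof.
  induction m; simpl; intros H; auto. rewrite IHm, (H m) by (intros; try apply H; lia). auto.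
Qed.

Lemma sumR_plus m f g : sumR m (fun j => f j + g j) = sumR m f + sumR m g.
Proof. induction m; simpl; [|rewrite IHm]; ring. Qed.

Lemma sumR_minus m f g : sumR m (fun j => f j - g j) = sumR m f - sumR m g.
Proof. induction m; simpl; [|rewrite IHm]; ring. Qed.

Lemma sumR_scal m r f : sumR m (fun j => r * f j) = r * sumR m f.
Proof. induction m; simpl; [|rewrite IHm]; ring. Qed.

Lemma sumR_const m r : sumR m (fun _ => r) = INR m * r.
Proof. induction m; [simpl; ring|]. rewrite S_INR. simpl. rewrite IHm. ring. Qed.

Lemma sumR_le m f g : (forall j, (j < m)%nat -> f j <= g j) -> sumR m f <= sumR m g.
Proof.
  induction m; simpl; intros H; [lra|].
  apply Rplus_le_compat; [apply IHm; intros|]; apply H; lia.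
Qed.

Lemma sumR_zero m f : (forall j, (j < m)%nat -> f j = 0) -> sumR m f = 0.
Proof. intros H. rewrite (sumR_ext m f (fun _ => 0)) by auto. rewrite sumR_const. ring. Qed.

Lemma sumR_ge0 m f : (forall j, (j < m)%nat -> 0 <= f j) -> 0 <= sumR m f.
Proof. intros H. rewrite <- (sumR_zero m (fun _ => 0)) by auto. apply sumR_le, H. Qed.

Lemma sumR_term_le m f i :
  (forall j, (j < m)%nat -> 0 <= f j) -> (i < m)%nat -> f i <= sumR m f.
Proof.
  induction m; simpl; intros H Hi; [lia|].
  assert (Hm : 0 <= f m) by (apply H; lia).
  assert (Hs : 0 <= sumR m f) by (apply sumR_ge0; intros; apply H; lia).
  destruct (Nat.eq_dec i m) as [->|]; [lra|].
  assert (f i <= sumR m f) by (apply IHm; [intros; apply H|]; lia). lra.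
Qed.

Lemma sumR_delta m i r : (i < m)%nat -> sumR m (fun j => if Nat.eq_dec j i then r else 0) = r.
Proof.
  induction m; simpl; intros Hi; [lia|].
  destruct (Nat.eq_dec m i) as [->|].
  - rewrite sumR_zero; [ring|]. intros j Hj. destruct (Nat.eq_dec j i); [lia|auto].
  - rewrite IHm by lia. ring.
Qed.

(** * The Euclidean norm on $\mathbb R^d$: Cauchy-Schwarz, duality, triangle inequality *)

Section Norm.
Variable d : nat.

Lemma sq_sum_ge0 v : 0 <= sumR d (fun c => (v c)^2).
Proof. apply sumR_ge0; intros; apply pow2_ge_0. Qed.

Lemma norm_ge0 v : 0 <= norm_d d v.
Proof. apply sqrt_pos. Qed.

Lemma norm_sq v : norm_d d v * norm_d d v = sumR d (fun c => (v c)^2).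
Proof. apply sqrt_sqrt, sq_sum_ge0. Qed.

Lemma norm_ext v v' : (forall c, (c < d)%nat -> v c = v' c) -> norm_d d v = norm_d d v'.
Proof.
  intros H. unfold norm_d. f_equal. apply sumR_ext. intros c Hc. now rewrite H.
Qed.

Lemma norm_zero v : (forall c, (c < d)%nat -> v c = 0) -> norm_d d v = 0.
Proof.
  intros H. unfold norm_d. rewrite sumR_zero; [apply sqrt_0|].
  intros c Hc. rewrite H by auto. ring.
Qed.

(** The quadratic form $|s f - t g|^2$ is nonnegative for all $s,t$. Evaluating it at $s=|g|$,
    $t=|f|$ gives the bound when both norms are nonzero; if one vanishes, another choice of $s,t$
    forces the inner product to be 0. *)
Lemma cauchy_schwarz f g : sumR d (fun c => f c * g c) <= norm_d d f * norm_d d g.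
Proof.
  pose proof (norm_ge0 f). pose proof (norm_ge0 g).
  pose proof (norm_sq f) as Hf. pose proof (norm_sq g) as Hg.
  set (X := norm_d d f) in *. set (Y := norm_d d g) in *. set (P := sumR d (fun c => f c * g c)).
  assert (Hq : forall s t, 0 <= s * s * (X * X) - 2 * s * t * P + t * t * (Y * Y)).
  { intros s t. rewrite Hf, Hg. unfold P.
    rewrite <- (sumR_scal d (s * s)), <- (sumR_scal d (2 * s * t)), <- (sumR_scal d (t * t)).
    rewrite <- sumR_minus, <- sumR_plus. apply sumR_ge0. intros c _.
    replace (_ + _) with ((s * f c - t * g c)^2) by ring. apply pow2_ge_0. }
  destruct (Req_dec X 0) as [HX|HX].
  { pose proof (Hq (Y * Y + 1) P) as H1. pose proof (Hq (- (Y * Y + 1)) (- P)).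
    rewrite HX in *. rewrite Rmult_0_l. apply Rnot_lt_le. intros HP.
    assert (0 < P * P) by nra. pose proof (Rle_0_sqr Y) as HY. unfold Rsqr in HY. nra. }
  destruct (Req_dec Y 0) as [HY|HY].
  { pose proof (Hq P (X * X + 1)) as H1. rewrite HY in *. rewrite Rmult_0_r.
    apply Rnot_lt_le. intros HP.
    assert (0 < P * P) by nra. pose proof (Rle_0_sqr X) as HX'. unfold Rsqr in HX'. nra. }
  pose proof (Hq Y X) as H1. assert (0 < X * Y) by (apply Rmult_lt_0_compat; lra).
  apply Rnot_lt_le. intros HP.
  assert (0 < (X * Y) * (P - X * Y)) by (apply Rmult_lt_0_compat; lra). nra.
Qed.

(** Testing [v] against itself turns a bound on an inner product into a bound on the norm. This
    yields both the triangle inequality and the norm bound for vector integrals. *)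
Lemma norm_le_dual v r : 0 <= r ->
  sumR d (fun c => v c * v c) <= norm_d d v * r -> norm_d d v <= r.
Proof.
  intros Hr H. pose proof (norm_ge0 v).
  replace (sumR d (fun c => v c * v c)) with (norm_d d v * norm_d d v) in H
    by (rewrite norm_sq; apply sumR_ext; intros; ring).
  apply Rnot_lt_le. intros Hlt. nra.
Qed.

Lemma norm_triang f g : norm_d d (fun c => f c + g c) <= norm_d d f + norm_d d g.
Proof.
  apply norm_le_dual. { pose proof (norm_ge0 f). pose proof (norm_ge0 g). lra. }
  pose proof (cauchy_schwarz (fun c => f c + g c) f).
  pose proof (cauchy_schwarz (fun c => f c + g c) g).
  rewrite (sumR_ext d _ (fun c => (f c + g c) * f c + (f c + g c) * g c)) by (intros; ring).
  rewrite sumR_plus. lra.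
Qed.

Lemma norm_scal r f : norm_d d (fun c => r * f c) = Rabs r * norm_d d f.
Proof.
  unfold norm_d. rewrite (sumR_ext d _ (fun c => (r * r) * (f c)^2)) by (intros; ring).
  rewrite sumR_scal, sqrt_mult; [|apply Rle_0_sqr|apply sq_sum_ge0].
  now rewrite <- sqrt_Rsqr_abs.
Qed.

Lemma norm_le_sum v : norm_d d v <= sumR d (fun c => Rabs (v c)).
Proof.
  unfold norm_d. induction d as [|m IH]; simpl; [rewrite sqrt_0; lra|].
  assert (0 <= sumR m (fun c => v c * (v c * 1))).
  { apply sumR_ge0. intros. nra. }
  pose proof (Rabs_pos (v m)) as Ha.
  assert (Hs : v m * (v m * 1) = Rabs (v m) * Rabs (v m)).
  { rewrite <- Rabs_mult, Rabs_right by nra. ring. }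
  rewrite Hs. pose proof (sqrt_pos (sumR m (fun c => v c * (v c * 1)))) as Hp.
  apply Rle_trans with (sqrt (sumR m (fun c => v c * (v c * 1))) + Rabs (v m)); [|simpl in IH; lra].
  rewrite <- (sqrt_Rsqr (sqrt (sumR m (fun c => v c * (v c * 1))) + Rabs (v m))) by lra.
  apply sqrt_le_1_alt. unfold Rsqr. pose proof (sqrt_sqrt _ H). nra.
Qed.

End Norm.

(* [v] is within [r] of a combination of the leaders with nonnegative weights of total mass
   [C]; letting [C] vary makes convexity estimates additive. *)
Definition near (k d : nat) (y : State) (C : R) (v : Vec) (r : R) : Prop :=
  exists mu : nat -> R, (forall j, (j < k)%nat -> 0 <= mu j) /\ sumR k mu = C /\
    norm_d d (fun c => v c - sumR k (fun j => mu j * y j c)) <= r.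

(** * Arithmetic of nonnegative combinations of leaders and the distance to their hull *)

Section Near.
Variables k d : nat.

Lemma near_weaken y C v r v' r' :
  near k d y C v r -> (forall c, (c < d)%nat -> v' c = v c) -> r <= r' -> near k d y C v' r'.
Proof.
  intros (mu & H1 & H2 & H3) Hv Hr. exists mu. repeat split; auto.
  eapply Rle_trans; [|exact (Rle_trans _ _ _ H3 Hr)].
  apply Req_le, norm_ext. intros c Hc. now rewrite Hv.
Qed.

Lemma near_plus y C v r C' v' r' :
  near k d y C v r -> near k d y C' v' r' ->
  near k d y (C + C') (fun c => v c + v' c) (r + r').
Proof.
  intros (mu & H1 & H2 & H3) (mu' & H1' & H2' & H3').
  exists (fun j => mu j + mu' j). repeat split.
  - intros j Hj. specialize (H1 j Hj). specialize (H1' j Hj). lra.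
  - rewrite sumR_plus. lra.
  - eapply Rle_trans; [|exact (Rplus_le_compat _ _ _ _ H3 H3')].
    eapply Rle_trans; [|apply norm_triang]. apply Req_le, norm_ext. intros c _.
    rewrite (sumR_ext k _ (fun j => mu j * y j c + mu' j * y j c)) by (intros; ring).
    rewrite sumR_plus. ring.
Qed.

Lemma near_scal y C v r a :
  0 <= a -> near k d y C v r -> near k d y (a * C) (fun c => a * v c) (a * r).
Proof.
  intros Ha (mu & H1 & H2 & H3). exists (fun j => a * mu j). repeat split.
  - intros j Hj. apply Rmult_le_pos; auto.
  - rewrite sumR_scal. now rewrite H2.
  - eapply Rle_trans; [|exact (Rmult_le_compat_l _ _ _ Ha H3)].
    rewrite <- (Rabs_pos_eq a Ha), <- norm_scal, (Rabs_pos_eq a Ha).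
    apply Req_le, norm_ext. intros c _.
    rewrite (sumR_ext k _ (fun j => a * (mu j * y j c))) by (intros; ring).
    rewrite sumR_scal. ring.
Qed.

Lemma near_zero y : near k d y 0 (fun _ => 0) 0.
Proof.
  exists (fun _ => 0). repeat split; [intros; lra|now apply sumR_zero|].
  apply Req_le, norm_zero. intros c _. rewrite sumR_zero; [ring|]. intros; ring.
Qed.

Lemma near_sum y m C v r :
  (forall j, (j < m)%nat -> near k d y (C j) (v j) (r j)) ->
  near k d y (sumR m C) (fun c => sumR m (fun j => v j c)) (sumR m r).
Proof.
  induction m; simpl; intros H; [apply near_zero|].
  apply near_plus; [apply IHm; intros|]; apply H; lia.
Qed.

Lemma near_vertex y l : (l < k)%nat -> near k d y 1 (y l) 0.
Proof.
  intros Hl. exists (fun j => if Nat.eq_dec j l then 1 else 0). repeat split.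
  - intros j _. destruct (Nat.eq_dec j l); lra.
  - now apply sumR_delta.
  - apply Req_le, norm_zero. intros c _.
    rewrite (sumR_ext k _ (fun j => if Nat.eq_dec j l then y l c else 0)).
    + rewrite sumR_delta by auto. ring.
    + intros j _. destruct (Nat.eq_dec j l) as [->|]; ring.
Qed.

Lemma near_perturb y C v r e v' :
  near k d y C v r -> norm_d d (fun c => v' c - v c) <= e -> near k d y C v' (r + e).
Proof.
  intros (mu & H1 & H2 & H3) He. exists mu. repeat split; auto.
  eapply Rle_trans; [|exact (Rplus_le_compat _ _ _ _ H3 He)].
  eapply Rle_trans; [|apply norm_triang]. apply Req_le, norm_ext. intros; ring.
Qed.

Lemma norm_sum_le m (f : nat -> Vec) :
  norm_d d (fun c => sumR m (fun j => f j c)) <= sumR m (fun j => norm_d d (f j)).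
Proof.
  induction m; simpl; [apply Req_le, norm_zero; auto|].
  eapply Rle_trans; [apply norm_triang|]. lra.
Qed.

(** The same weights are used for the displaced leaders; since they sum to 1, the combination moves
    by at most [e]. *)
Lemma near_move y y' v r e :
  (forall l, (l < k)%nat -> norm_d d (fun c => y' l c - y l c) <= e) ->
  near k d y 1 v r -> near k d y' 1 v (r + e).
Proof.
  intros He (mu & H1 & H2 & H3). exists mu. repeat split; auto.
  apply Rle_trans with (norm_d d (fun c => v c - sumR k (fun j => mu j * y j c)) +
    norm_d d (fun c => sumR k (fun j => - mu j * (y' j c - y j c)))).
  - eapply Rle_trans; [|apply norm_triang]. apply Req_le, norm_ext. intros c _.
    rewrite (sumR_ext k (fun j => - mu j * _) (fun j => mu j * y j c - mu j * y' j c))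
      by (intros; ring).
    rewrite sumR_minus. ring.
  - apply Rplus_le_compat; auto. eapply Rle_trans; [apply norm_sum_le|].
    apply Rle_trans with (sumR k (fun j => e * mu j)); [|rewrite sumR_scal, H2; lra].
    apply sumR_le. intros j Hj. rewrite norm_scal, Rabs_Ropp, Rabs_right by (apply Rle_ge; auto).
    rewrite Rmult_comm. apply Rmult_le_compat_r; auto.
Qed.

Lemma is_inf_exists S b : (exists s, S s) -> (forall s, S s -> b <= s) -> exists r, is_inf S r.
Proof.
  intros [s0 Hs0] Hb.
  destruct (completeness (fun r => S (- r))) as [m [Hm1 Hm2]].
  - exists (- b). intros r Hr. specialize (Hb _ Hr). lra.
  - exists (- s0). now rewrite Ropp_involutive.
  - exists (- m). split.
    + intros s Hs. enough (- s <= m) by lra. apply Hm1. now rewrite Ropp_involutive.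
    + intros b' Hb'. enough (m <= - b') by lra. apply Hm2. intros r Hr.
      specialize (Hb' _ Hr). lra.
Qed.

Hypothesis hk : (1 <= k)%nat.

(** [hull_dist] is defined by choice, so it has to be shown that an infimum exists: distances are
    bounded below by 0, and the hull is nonempty because there is a leader. *)
Lemma hull_dist_inf y v :
  is_inf (fun s => exists p, in_hull k d y p /\ s = norm_d d (fun c => v c - p c)) (hull_dist k d y v).
Proof.
  unfold hull_dist. apply epsilon_spec. apply is_inf_exists with 0.
  - destruct (near_vertex y 0) as (mu & H1 & H2 & _); [lia|].
    exists (norm_d d (fun c => v c - sumR k (fun j => mu j * y j c))).
    eexists. split; [|reflexivity]. exists mu. auto.
  - intros s (p & _ & ->). apply norm_ge0.
Qed.

Lemma hull_dist_le_near y v r : near k d y 1 v r -> hull_dist k d y v <= r.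
Proof.
  intros (mu & H1 & H2 & H3). eapply Rle_trans; [|exact H3]. apply hull_dist_inf.
  eexists. split; [|reflexivity]. exists mu. auto.
Qed.

(** Attainment of the infimum is avoided by a slack [e], which later estimates send to 0. *)
Lemma hull_dist_near y v e : 0 < e -> near k d y 1 v (hull_dist k d y v + e).
Proof.
  intros He. apply NNPP. intros Hn.
  enough (hull_dist k d y v + e <= hull_dist k d y v) by lra.
  apply (proj2 (hull_dist_inf y v)). intros s (p & (mu & H1 & H2 & H3) & ->).
  apply Rnot_lt_le. intros Hlt. apply Hn. exists mu. repeat split; auto.
  eapply Rle_trans; [|apply Rlt_le; exact Hlt]. apply Req_le, norm_ext.
  intros c Hc. now rewrite H3.
Qed.

Lemma hull_dist_perturb y y' v v' e e' :
  norm_d d (fun c => v' c - v c) <= e ->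
  (forall l, (l < k)%nat -> norm_d d (fun c => y' l c - y l c) <= e') ->
  hull_dist k d y' v' <= hull_dist k d y v + e + e'.
Proof.
  intros He He'. apply Rle_plus_epsilon. intros eps Heps.
  apply Rle_trans with (hull_dist k d y v + eps + e + e'); [|lra].
  apply hull_dist_le_near. apply near_move with y; auto.
  apply near_perturb with v; auto. now apply hull_dist_near.
Qed.

End Near.

(** * Real analysis: continuity along a filter, a Dini comparison lemma, integrals *)

(** Let $m$ be the supremum of the points up to which [P] holds throughout. Closure from the left
    gives [P] at $m$, and propagation to the right would carry [P] beyond $m$ if $m$ were short of
    the target. *)
Lemma real_induction (P : R -> Prop) (a b : R) :
  P a ->
  (forall t, a <= t < b -> P t -> exists delta, 0 < delta /\
     forall s, t < s < t + delta -> s <= b -> P s) ->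
  (forall t, a < t <= b -> (forall s, a <= s < t -> P s) -> P t) ->
  forall t, a <= t <= b -> P t.
Proof.
  intros H0 Hr Hl t Ht.
  set (E := fun r => a <= r <= t /\ forall s, a <= s <= r -> P s).
  destruct (completeness E) as [m [Hm1 Hm2]].
  { exists t. intros r [Hr' _]. lra. }
  { exists a. split; [lra|]. intros s Hs. now replace s with a by lra. }
  assert (Ham : a <= m).
  { apply Hm1. split; [lra|]. intros s Hs. now replace s with a by lra. }
  assert (Hmt : m <= t) by (apply Hm2; intros r [Hr' _]; lra).
  assert (Hlt : forall s, a <= s < m -> P s).
  { intros s Hs. apply NNPP. intros Hn. enough (m <= s) by lra.
    apply Hm2. intros r [Hr1 Hr2]. apply Rnot_lt_le. intros Hlt.
    apply Hn, Hr2. lra. }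
  assert (HPm : P m).
  { destruct (Req_dec a m) as [<-|Hne]; auto. apply Hl; auto. lra. }
  destruct (Req_dec m t) as [->|Hne]; auto. exfalso.
  destruct (Hr m) as (delta & Hd & Hs); [lra|auto|].
  set (r := Rmin t (m + delta / 2)).
  assert (Hr1 : m < r <= t) by (unfold r, Rmin; destruct Rle_dec; lra).
  assert (Hr2 : r < m + delta) by (unfold r, Rmin; destruct Rle_dec; lra).
  enough (r <= m) by lra. apply Hm1. split; [lra|].
  intros s Hs'. destruct (Rlt_le_dec s m); [apply Hlt; lra|].
  destruct (Req_dec s m) as [->|]; auto. apply Hs; lra.
Qed.

(** The filter is a parameter so that one set of algebraic rules serves continuity in time relative
    to a set as well as continuity in finitely many coordinates. *)
Definition cont_at {U : Type} (F : (U -> Prop) -> Prop) (f : U -> R) (p : U) : Prop :=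
  filterlim f F (locally (f p)).

Lemma cont_at_const {U} (F : (U -> Prop) -> Prop) {FF : Filter F} r p : cont_at F (fun _ => r) p.
Proof. apply filterlim_const. Qed.

Lemma cont_at_plus {U} (F : (U -> Prop) -> Prop) {FF : Filter F} f g p :
  cont_at F f p -> cont_at F g p -> cont_at F (fun s => f s + g s) p.
Proof.
  intros Hf Hg. unfold cont_at.
  eapply filterlim_comp_2; [exact Hf|exact Hg|apply (filterlim_plus (f p) (g p))].
Qed.

Lemma cont_at_mult {U} (F : (U -> Prop) -> Prop) {FF : Filter F} f g p :
  cont_at F f p -> cont_at F g p -> cont_at F (fun s => f s * g s) p.
Proof.
  intros Hf Hg. unfold cont_at.
  eapply filterlim_comp_2; [exact Hf|exact Hg|apply (filterlim_mult (f p) (g p))].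
Qed.

Lemma cont_at_minus {U} (F : (U -> Prop) -> Prop) {FF : Filter F} f g p :
  cont_at F f p -> cont_at F g p -> cont_at F (fun s => f s - g s) p.
Proof.
  intros Hf Hg. apply cont_at_plus; auto.
  eapply filterlim_comp; [exact Hg|apply (filterlim_opp (g p))].
Qed.

Lemma cont_at_sum {U} (F : (U -> Prop) -> Prop) {FF : Filter F} m (f : nat -> U -> R) p :
  (forall j, (j < m)%nat -> cont_at F (f j) p) -> cont_at F (fun s => sumR m (fun j => f j s)) p.
Proof.
  induction m; simpl; intros H; [apply cont_at_const; auto|].
  apply cont_at_plus; [auto|apply IHm; intros|]; apply H; lia.
Qed.

(** Continuity is relative to [D] because trajectories are constrained only on $[0,T)$. *)
Definition cont_on (D : R -> Prop) : (R -> R) -> R -> Prop :=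
  fun f t => cont_at (within D (locally t)) f t.

Lemma cont_on_iff D f t :
  cont_on D f t <-> forall eps, 0 < eps -> exists delta, 0 < delta /\
    forall s, D s -> Rabs (s - t) < delta -> Rabs (f s - f t) < eps.
Proof.
  split.
  - intros H eps He.
    destruct (H (fun r => Rabs (r - f t) < eps)) as [delta Hd].
    { exists (mkposreal eps He). intros r Hr. exact Hr. }
    exists delta. split; [apply cond_pos|]. intros s Hs Hst. apply (Hd s); auto.
  - intros H P [eps HP]. destruct (H eps (cond_pos eps)) as (delta & Hd & Hs).
    exists (mkposreal delta Hd). intros s Hst HD. apply HP, Hs; auto.
Qed.

Lemma cont_on_sub (D D' : R -> Prop) f t :
  (forall s, D' s -> D s) -> cont_on D f t -> cont_on D' f t.
Proof.
  rewrite !cont_on_iff. intros HD H eps He. destruct (H eps He) as (delta & Hd & Hs).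
  exists delta. split; auto.
Qed.

Lemma cont_on_continuity D f t : continuity f -> cont_on D f t.
Proof.
  intros H. apply cont_on_sub with (fun _ => True); auto. apply cont_on_iff.
  intros eps He. destruct (H t eps He) as (delta & Hd & Hs). exists delta. split; auto.
  intros s _ Hst. destruct (Req_dec s t) as [->|Hne].
  - unfold Rminus. now rewrite Rplus_opp_r, Rabs_R0.
  - apply (Hs s). split; [split; [exact I|auto]|exact Hst].
Qed.

Lemma finite_delta m (P : nat -> R -> Prop) :
  (forall i, (i < m)%nat -> exists delta, 0 < delta /\ forall r, 0 < r <= delta -> P i r) ->
  exists delta, 0 < delta /\ forall i, (i < m)%nat -> P i delta.
Proof.
  intros H. enough (exists delta, 0 < delta /\ forall i, (i < m)%nat -> forall r, 0 < r <= delta -> P i r)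
    as (delta & Hd & HP) by (exists delta; split; auto; intros; apply HP; auto; lra).
  induction m.
  - exists 1. split; [lra|]. intros; lia.
  - destruct IHm as (d1 & H1 & HP1); [intros; apply H; lia|].
    destruct (H m) as (d2 & H2 & HP2); [lia|].
    exists (Rmin d1 d2). split; [apply Rmin_pos; auto|]. intros i Hi r Hr.
    pose proof (Rmin_l d1 d2). pose proof (Rmin_r d1 d2).
    destruct (Nat.eq_dec i m) as [->|]; [apply HP2|apply HP1; [lia|]]; lra.
Qed.

Lemma finite_threshold m (P : nat -> R -> Prop) :
  (forall i, (i < m)%nat -> exists tau, forall r, tau <= r -> P i r) ->
  exists tau, 0 <= tau /\ forall i, (i < m)%nat -> forall r, tau <= r -> P i r.
Proof.
  induction m; intros H.
  - exists 0. split; [lra|]. intros; lia.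
  - destruct IHm as (d1 & H1 & HP1); [intros; apply H; lia|].
    destruct (H m) as (d2 & HP2); [lia|].
    exists (Rmax d1 d2). pose proof (Rmax_l d1 d2). pose proof (Rmax_r d1 d2).
    split; [lra|]. intros i Hi r Hr.
    destruct (Nat.eq_dec i m) as [->|]; [apply HP2|apply HP1; [lia|]]; lra.
Qed.

Lemma exp_ge_1p x : 1 + x <= exp x.
Proof.
  destruct (Req_dec x 0) as [->|Hx]; [rewrite exp_0; lra|]. left. now apply exp_ineq1.
Qed.

(* The barrier A exp(-c(t-a)) + eta(1+t-a) is convex, so it lies above its tangent
   lines and no error term in theta appears on its side of the comparison. *)
Lemma dini_decay (g : R -> R) (a b c : R) :
  a <= b -> 0 <= c ->
  (forall t, a <= t <= b -> cont_on (fun s => a <= s <= b) g t) ->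
  (forall t, a <= t < b -> 0 < g t -> forall eta, 0 < eta -> exists delta, 0 < delta /\
     forall theta, 0 < theta < delta -> t + theta <= b ->
       g (t + theta) <= g t - c * theta * g t + eta * theta) ->
  Rmax 0 (g b) <= exp (- c * (b - a)) * Rmax 0 (g a).
Proof.
  intros Hab Hc Hcont Hd. set (A := Rmax 0 (g a)).
  assert (HA : 0 <= A) by apply Rmax_l.
  assert (HAe : 0 <= exp (- c * (b - a)) * A)
    by (apply Rmult_le_pos; [apply Rlt_le, exp_pos|auto]).
  apply Rmax_lub; auto. apply Rnot_lt_le. intros Hlt.
  (* This slope places the barrier at time [b] halfway between the claimed bound and [g b], so
     reaching [g b <= Phi b] is a contradiction. *)
  set (eta := (g b - exp (- c * (b - a)) * A) / (2 * (1 + (b - a)))).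
  assert (Heta : 0 < eta) by (apply Rdiv_lt_0_compat; lra).
  set (Phi := fun t => exp (- c * (t - a)) * A + eta * (1 + (t - a))).
  assert (Hgb : Phi b < g b).
  { assert (eta * (1 + (b - a)) = (g b - exp (- c * (b - a)) * A) / 2)
      by (unfold eta; field; lra). unfold Phi. lra. }
  assert (HPhi : forall t, a <= t -> 0 < Phi t).
  { intros t Ht. unfold Phi. pose proof (exp_pos (- c * (t - a))). nra. }
  assert (Htan : forall t theta, a <= t -> 0 < theta ->
            Phi t - c * theta * Phi t + eta * theta <= Phi (t + theta)).
  { intros t th Ht Hth. unfold Phi.
    replace (- c * (t + th - a)) with (- c * (t - a) + - (c * th)) by ring.
    rewrite exp_plus. pose proof (exp_ge_1p (- (c * th))).
    pose proof (exp_pos (- c * (t - a))). set (e := exp (- c * (t - a))) in *.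
    assert (e * A * (1 + - (c * th)) <= e * A * exp (- (c * th)))
      by (apply Rmult_le_compat_l; nra).
    assert (0 <= eta * c * th * (1 + (t - a)))
      by (apply Rmult_le_pos; [apply Rmult_le_pos; [apply Rmult_le_pos|]|]; lra).
    lra. }
  assert (HPc : forall D t, cont_on D Phi t).
  { intros D t. apply cont_on_continuity. unfold Phi. reg. }
  enough (Hg : g b <= Phi b) by lra.
  apply (real_induction (fun t => g t <= Phi t) a b); [| | |lra].
  - unfold Phi. rewrite Rminus_diag, Rmult_0_r, exp_0.
    pose proof (Rmax_r 0 (g a)). fold A in H. lra.
  (* Only at a contact point is the Dini hypothesis required; there [g t] equals the positive
     [Phi t], and the tangent estimate closes the step. Strictly below the barrier, continuity
     suffices. *)
  - intros t Ht Hgt. destruct (Req_dec (g t) (Phi t)) as [He|Hne].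
    + pose proof (HPhi t ltac:(lra)).
      destruct (Hd t Ht ltac:(lra) eta Heta) as (delta & Hdel & Hs).
      exists delta. split; auto. intros s Hs1 Hs2.
      specialize (Hs (s - t) ltac:(lra)). specialize (Htan t (s - t) ltac:(lra) ltac:(lra)).
      replace (t + (s - t)) with s in * by ring. rewrite He in Hs. specialize (Hs Hs2). lra.
    + pose proof (proj1 (cont_on_iff _ _ _) (Hcont t ltac:(lra)) ((Phi t - g t) / 2) ltac:(lra))
        as (d1 & Hd1 & Hs1).
      pose proof (proj1 (cont_on_iff _ _ _) (HPc (fun _ => True) t) ((Phi t - g t) / 2) ltac:(lra))
        as (d2 & Hd2 & Hs2).
      exists (Rmin d1 d2). split; [apply Rmin_pos; auto|]. intros s Hst Hsb.
      pose proof (Rmin_l d1 d2). pose proof (Rmin_r d1 d2).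
      assert (Hab' : Rabs (s - t) = s - t) by (apply Rabs_right; lra).
      specialize (Hs1 s ltac:(lra) ltac:(lra)). specialize (Hs2 s I ltac:(lra)).
      apply Rabs_def2 in Hs1. apply Rabs_def2 in Hs2. lra.
  - intros t Ht Hs. apply Rnot_lt_le. intros Hlt'.
    pose proof (proj1 (cont_on_iff _ _ _) (Hcont t ltac:(lra)) ((g t - Phi t) / 2) ltac:(lra))
      as (d1 & Hd1 & Hs1).
    pose proof (proj1 (cont_on_iff _ _ _) (HPc (fun _ => True) t) ((g t - Phi t) / 2) ltac:(lra))
      as (d2 & Hd2 & Hs2).
    set (s := Rmax a (t - Rmin d1 d2 / 2)).
    pose proof (Rmin_l d1 d2). pose proof (Rmin_r d1 d2). pose proof (Rmin_pos _ _ Hd1 Hd2).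
    assert (Hs' : a <= s < t /\ t - s <= Rmin d1 d2 / 2)
      by (unfold s, Rmax; destruct Rle_dec; lra).
    assert (Rabs (s - t) = t - s) by (rewrite Rabs_left; lra).
    specialize (Hs s ltac:(lra)). specialize (Hs1 s ltac:(lra) ltac:(lra)).
    specialize (Hs2 s I ltac:(lra)).
    apply Rabs_def2 in Hs1. apply Rabs_def2 in Hs2. lra.
Qed.

Lemma is_RInt_cst (a b r l : R) : l = (b - a) * r -> is_RInt (fun _ => r) a b l.
Proof. intros ->. apply (is_RInt_const a b r). Qed.

Lemma is_RInt_sumR m (f : nat -> R -> R) (l : nat -> R) a b :
  (forall j, (j < m)%nat -> is_RInt (f j) a b (l j)) ->
  is_RInt (fun s => sumR m (fun j => f j s)) a b (sumR m l).
Proof.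
  induction m; simpl; intros H.
  - apply is_RInt_cst. ring.
  - apply (is_RInt_plus (fun s => sumR m (fun j => f j s)) (f m)); [apply IHm; intros|]; apply H; lia.
Qed.

(** The integrand is paired with its own integral [V] as a constant vector; Cauchy-Schwarz under the
    integral gives $|V|^2 \le |V| P$. *)
Lemma norm_integral_le d (v : R -> Vec) (V : Vec) (rho : R -> R) (P a b : R) :
  a <= b -> (forall c, (c < d)%nat -> is_RInt (fun s => v s c) a b (V c)) ->
  is_RInt rho a b P -> (forall s, a < s < b -> norm_d d (v s) <= rho s) ->
  norm_d d V <= P.
Proof.
  intros Hab HV HP Hle. apply norm_le_dual.
  - apply (is_RInt_le (fun _ => 0) rho a b); auto. { apply is_RInt_cst. ring. }
    intros s Hs. eapply Rle_trans; [apply norm_ge0|apply (Hle s Hs)].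
  - apply (is_RInt_le (fun s => sumR d (fun c => V c * v s c)) (fun s => norm_d d V * rho s) a b); auto.
    + apply is_RInt_sumR. intros c Hc. apply (is_RInt_scal (fun s => v s c)). now apply HV.
    + now apply (is_RInt_scal rho).
    + intros s Hs. eapply Rle_trans; [apply cauchy_schwarz|].
      apply Rmult_le_compat_l; [apply norm_ge0|auto].
Qed.

(** The integral form of $g'=f$. It is used instead of a derivative because the right-hand side
    jumps at switching instants. *)
Definition primitive_on (T : R) (f g : R -> R) : Prop :=
  forall t1 t2, 0 <= t1 -> t1 <= t2 -> t2 < T -> is_RInt f t1 t2 (g t2 - g t1).

Lemma primitive_on_Riemann T f g :
  (forall t, 0 <= t < T -> exists pr : Riemann_integrable f 0 t, g t = g 0 + RiemannInt pr) ->
  primitive_on T f g.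
Proof.
  intros H t1 t2 H1 H12 H2.
  assert (HI : forall t, 0 <= t < T -> ex_RInt f 0 t /\ g t = g 0 + RInt f 0 t).
  { intros t Ht. destruct (H t Ht) as [pr Hpr].
    split; [now apply ex_RInt_Reals_1|]. now rewrite (RInt_Reals f 0 t pr). }
  destruct (HI t1) as [E1 G1]; [lra|]. destruct (HI t2) as [E2 G2]; [lra|].
  assert (E12 : ex_RInt f t1 t2) by (apply (ex_RInt_Chasles_2 (V := R_CompleteNormedModule) f 0 t1 t2); [lra|auto]).
  replace (g t2 - g t1) with (RInt f t1 t2); [now apply (RInt_correct f)|].
  pose proof (RInt_Chasles f 0 t1 t2 E1 E12) as HC. unfold plus in HC; simpl in HC. lra.
Qed.

(** A Riemann integrable function is bounded, so its primitive is Lipschitz on each $[0,t']$ with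
    $t'<T$; [t'] is taken beyond [t] to cover both sides. *)
Lemma primitive_on_cont T f g t :
  primitive_on T f g -> 0 <= t < T -> cont_on (fun s => 0 <= s < T) g t.
Proof.
  intros H Ht. set (t' := (t + T) / 2).
  assert (Ht' : t < t' < T) by (unfold t'; lra).
  destruct (ex_RInt_ub f 0 t') as [M1 HM1].
  { eexists. apply H; lra. }
  set (M := Rmax 1 M1).
  assert (HM : 1 <= M) by apply Rmax_l.
  assert (HMf : forall s, 0 <= s <= t' -> - M <= f s <= M).
  { intros s Hs. rewrite Rmin_left, Rmax_right in HM1 by lra.
    specialize (HM1 s Hs). pose proof (Rmax_r 1 M1). apply Rabs_le_between.
    change (norm (f s)) with (Rabs (f s)) in HM1. unfold M. lra. }
  assert (HL : forall s1 s2, 0 <= s1 <= s2 -> s2 <= t' -> Rabs (g s2 - g s1) <= M * (s2 - s1)).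
  { intros s1 s2 H1 H2. assert (HI := H s1 s2 ltac:(lra) ltac:(lra) ltac:(lra)).
    apply Rabs_le. split.
    - apply (is_RInt_le (fun _ => - M) f s1 s2); auto; [lra|apply is_RInt_cst; ring|].
      intros s Hs. apply HMf. lra.
    - apply (is_RInt_le f (fun _ => M) s1 s2); auto; [lra|apply is_RInt_cst; ring|].
      intros s Hs. apply HMf. lra. }
  apply cont_on_iff. intros eps He. exists (Rmin (t' - t) (eps / M)).
  split. { apply Rmin_pos; [lra|apply Rdiv_lt_0_compat; lra]. }
  intros s Hs Hst. pose proof (Rmin_l (t' - t) (eps / M)). pose proof (Rmin_r (t' - t) (eps / M)).
  assert (HMe : M * (eps / M) = eps) by (field; lra).
  apply Rabs_def2 in Hst as Hst'.
  assert (M * Rabs (s - t) < eps) by (rewrite <- HMe; apply Rmult_lt_compat_l; lra).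
  destruct (Rle_lt_dec t s) as [Hle|Hlt].
  - rewrite (Rabs_right (s - t)) in * by lra. specialize (HL t s ltac:(lra) ltac:(lra)). lra.
  - rewrite (Rabs_left (s - t)) in * by lra. specialize (HL s t ltac:(lra) ltac:(lra)).
    rewrite Rabs_minus_sym. lra.
Qed.

(** * Differential inequality for the distance of a follower to the hull *)

(** [rhsF] without the noise. As the topology is an argument, it can be frozen at one instant while
    the weights and states keep evolving. *)
Definition drift (n k : nat) (NF NL : R -> nat -> nat -> bool)
  (a b : nat -> nat -> State -> State -> R -> R) (x y : R -> State) (s : R) (i c : nat) : R :=
  sumR n (fun j => if NF s j i then a i j (x s) (y s) s * (x s j c - x s i c) else 0)
  + sumR k (fun j => if NL s j i then b i j (x s) (y s) s * (y s j c - x s i c) else 0).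

Section Trajectory.
Variables (n k d : nat) (NF NL : R -> nat -> nat -> bool).
Variables (a b : nat -> nat -> State -> State -> R -> R) (alo ahi blo : R).
Hypothesis hk : (1 <= k)%nat.
Hypothesis hw : weights_ok n k d a b alo ahi blo.
Variables (u : nat -> State -> R -> Vec) (w : nat -> R -> Vec) (T : R) (x y : R -> State).
Hypothesis hadm : admissible n k d u w.
Hypothesis hsol : solves n k d NF NL a b u w T x y.

Let z := znorm n k d u w y.
Let h i s := hull_dist k d (y s) (x s i).
Let D s := 0 <= s < T.

Lemma primitive_leader l c : (l < k)%nat -> (c < d)%nat ->
  primitive_on T (fun s => u l (y s) s c) (fun s => y s l c).
Proof. intros Hl Hc. apply primitive_on_Riemann. intros t Ht. now apply (hsol t Ht). Qed.

Lemma primitive_follower i c : (i < n)%nat -> (c < d)%nat ->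
  primitive_on T (fun s => rhsF n k NF NL a b w x y s i c) (fun s => x s i c).
Proof. intros Hi Hc. apply primitive_on_Riemann. intros t Ht. now apply (hsol t Ht). Qed.

Lemma cont_leader l c t : (l < k)%nat -> (c < d)%nat -> D t -> cont_on D (fun s => y s l c) t.
Proof. intros Hl Hc Ht. now apply primitive_on_cont with (1 := primitive_leader l c Hl Hc). Qed.

Lemma cont_follower i c t : (i < n)%nat -> (c < d)%nat -> D t -> cont_on D (fun s => x s i c) t.
Proof. intros Hi Hc Ht. now apply primitive_on_cont with (1 := primitive_follower i c Hi Hc). Qed.

Lemma state_close (xx : R -> State) m t delta :
  (forall i c, (i < m)%nat -> (c < d)%nat -> cont_on D (fun s => xx s i c) t) -> 0 < delta ->
  exists e, 0 < e /\ forall s, D s -> Rabs (s - t) < e -> Defs.close m d delta (xx t) (xx s).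
Proof.
  intros H Hd.
  destruct (finite_delta m (fun i e => forall s, D s -> Rabs (s - t) < e ->
     forall c, (c < d)%nat -> Rabs (xx s i c - xx t i c) < delta)) as (e & He & HP).
  - intros i Hi.
    destruct (finite_delta d (fun c e => forall s, D s -> Rabs (s - t) < e ->
       Rabs (xx s i c - xx t i c) < delta)) as (e & He & HP).
    + intros c Hc. destruct (proj1 (cont_on_iff _ _ _) (H i c Hi Hc) delta Hd) as (e & He & HP).
      exists e. split; auto. intros r Hr s Hs Hst. apply HP; auto. lra.
    + exists e. split; auto. intros r Hr s Hs Hst c Hc. apply HP; auto. lra.
  - exists e. split; auto. intros s Hs Hst i c Hi Hc. now apply HP.
Qed.

Lemma cont_weight f t : cont_xyt n k d f -> D t -> cont_on D (fun s => f (x s) (y s) s) t.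
Proof.
  intros Hf Ht. apply cont_on_iff. intros eps He.
  destruct (Hf (x t) (y t) t eps He) as (delta & Hd & HP).
  destruct (state_close x n t delta) as (e1 & He1 & H1); auto.
  { intros. now apply cont_follower. }
  destruct (state_close y k t delta) as (e2 & He2 & H2); auto.
  { intros. now apply cont_leader. }
  exists (Rmin delta (Rmin e1 e2)). split; [repeat apply Rmin_pos; auto|].
  intros s Hs Hst.
  pose proof (Rmin_l delta (Rmin e1 e2)). pose proof (Rmin_r delta (Rmin e1 e2)).
  pose proof (Rmin_l e1 e2). pose proof (Rmin_r e1 e2).
  apply HP; [apply H1|apply H2|]; auto; lra.
Qed.

Lemma cont_frozen_drift NF' NL' i c t : (i < n)%nat -> (c < d)%nat -> D t ->
  cont_on D (fun s => drift n k (fun _ => NF') (fun _ => NL') a b x y s i c) t.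
Proof.
  intros Hi Hc Ht. destruct hw as (_ & _ & _ & Ha & Hb).
  assert (FF : Filter (within D (locally t))) by typeclasses eauto.
  unfold drift, cont_on. apply cont_at_plus; auto; apply cont_at_sum; auto; intros j Hj.
  - destruct (NF' j i); [|now apply cont_at_const]. apply cont_at_mult; auto.
    + apply cont_weight; auto. now apply Ha.
    + apply cont_at_minus; auto; now apply cont_follower.
  - destruct (NL' j i); [|now apply cont_at_const]. apply cont_at_mult; auto.
    + apply cont_weight; auto. now apply Hb.
    + apply cont_at_minus; auto; [now apply cont_leader|now apply cont_follower].
Qed.

Lemma noise_le_znorm i s : (i < n)%nat -> norm_d d (w i s) <= z s.
Proof.
  intros Hi. apply sqrt_le_1_alt.
  pose proof (sumR_term_le n (fun i => sumR d (fun c => (w i s c)^2)) i) as H.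
  simpl in H. assert (0 <= sumR k (fun l => sumR d (fun c => (u l (y s) s c)^2))).
  { apply sumR_ge0. intros. apply sq_sum_ge0. }
  specialize (H ltac:(intros; apply (sq_sum_ge0 d (w j s))) Hi).
  simpl. simpl in H0. lra.
Qed.

Lemma input_le_znorm l s : (l < k)%nat -> norm_d d (u l (y s) s) <= z s.
Proof.
  intros Hl. apply sqrt_le_1_alt.
  pose proof (sumR_term_le k (fun l => sumR d (fun c => (u l (y s) s c)^2)) l) as H.
  simpl in H. assert (0 <= sumR n (fun i => sumR d (fun c => (w i s c)^2))).
  { apply sumR_ge0. intros. apply sq_sum_ge0. }
  specialize (H ltac:(intros; apply (sq_sum_ge0 d (u j (y s) s))) Hl).
  simpl. simpl in H0. lra.
Qed.

Lemma z_ge0 s : 0 <= z s.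
Proof. apply sqrt_pos. Qed.

Lemma leader_displacement l t1 t2 P : (l < k)%nat -> 0 <= t1 -> t1 <= t2 -> t2 < T ->
  is_RInt z t1 t2 P -> norm_d d (fun c => y t2 l c - y t1 l c) <= P.
Proof.
  intros Hl H1 H12 H2 HP.
  apply (norm_integral_le d (fun s => u l (y s) s) _ z P t1 t2); auto.
  - intros c Hc. now apply primitive_leader.
  - intros s Hs. now apply input_le_znorm.
Qed.

Lemma cont_dist i t : (i < n)%nat -> D t -> cont_on D (h i) t.
Proof.
  intros Hi Ht. apply cont_on_iff. intros eps He.
  (* The motion of the follower and that of the leaders each cost at most [INR d * delta], which is
     below [eps / 2]. *)
  set (delta := eps / (4 * (INR d + 1))).
  assert (Hd0 : 0 <= INR d) by apply pos_INR.
  assert (Hdel : 0 < delta) by (apply Rdiv_lt_0_compat; lra).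
  assert (Hdd : INR d * delta < eps / 2).
  { apply Rle_lt_trans with ((INR d + 1) * delta - delta); [lra|].
    unfold delta at 1. replace ((INR d + 1) * (eps / (4 * (INR d + 1)))) with (eps / 4) by (field; lra). lra. }
  destruct (state_close x n t delta) as (e1 & He1 & H1); auto.
  { intros. now apply cont_follower. }
  destruct (state_close y k t delta) as (e2 & He2 & H2); auto.
  { intros. now apply cont_leader. }
  exists (Rmin e1 e2). split; [now apply Rmin_pos|]. intros s Hs Hst.
  pose proof (Rmin_l e1 e2). pose proof (Rmin_r e1 e2).
  specialize (H1 s Hs ltac:(lra)). specialize (H2 s Hs ltac:(lra)).
  assert (HB : forall v v' : Vec, (forall c, (c < d)%nat -> Rabs (v' c - v c) < delta) ->
    norm_d d (fun c => v' c - v c) <= INR d * delta).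
  { intros v v' H'. eapply Rle_trans; [apply norm_le_sum|]. rewrite <- sumR_const.
    apply sumR_le. intros c Hc. left. now apply H'. }
  assert (HB' : forall v v' : Vec, (forall c, (c < d)%nat -> Rabs (v' c - v c) < delta) ->
    norm_d d (fun c => v c - v' c) <= INR d * delta).
  { intros v v' H'. apply HB. intros c Hc. rewrite Rabs_minus_sym. now apply H'. }
  pose proof (hull_dist_perturb k d hk (y t) (y s) (x t i) (x s i) (INR d * delta) (INR d * delta)
    (HB _ _ (fun c Hc => H1 i c Hi Hc)) (fun l Hl => HB _ _ (fun c Hc => H2 l c Hl Hc))).
  pose proof (hull_dist_perturb k d hk (y s) (y t) (x s i) (x t i) (INR d * delta) (INR d * delta)
    (HB' _ _ (fun c Hc => H1 i c Hi Hc)) (fun l Hl => HB' _ _ (fun c Hc => H2 l c Hl Hc))).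
  unfold h. apply Rabs_def1; lra.
Qed.

Definition arc_sum_F (i : nat) (t : R) (f : nat -> R) : R :=
  sumR n (fun j => if NF t j i then a i j (x t) (y t) t * f j else 0).
Definition arc_sum_L (i : nat) (t : R) : R :=
  sumR k (fun l => if NL t l i then b i l (x t) (y t) t else 0).

Lemma arc_sum_L_ge0 i t : (i < n)%nat -> 0 <= arc_sum_L i t.
Proof.
  intros Hi. destruct hw as (_ & _ & Hb0 & _ & Hb). apply sumR_ge0. intros l Hl.
  destruct (NL t l i); [|lra]. destruct (Hb i l Hi Hl) as [_ H]. specialize (H (x t) (y t) t). lra.
Qed.

Lemma arc_sum_F_ge0 i t f : (i < n)%nat -> (forall j, (j < n)%nat -> NF t j i = true -> 0 <= f j) -> 0 <= arc_sum_F i t f.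
Proof.
  intros Hi Hf. destruct hw as (Ha0 & _ & _ & Ha & _). apply sumR_ge0. intros l Hl.
  destruct (NF t l i) eqn:E; [|lra]. destruct (Ha i l Hi Hl) as [_ H]. specialize (H (x t) (y t) t).
  apply Rmult_le_pos; auto. lra.
Qed.

(** For small [theta] an explicit Euler step is a convex combination of the follower, its
    in-neighbours and its leaders. By convexity the distances combine with the same weights, and
    leaders contribute 0. *)
Lemma near_averaged i t theta e : (i < n)%nat -> 0 <= theta -> 0 < e ->
  theta * (arc_sum_F i t (fun _ => 1) + arc_sum_L i t) <= 1 ->
  near k d (y t) 1 (fun c => x t i c + theta * drift n k NF NL a b x y t i c)
    ((1 - theta * (arc_sum_F i t (fun _ => 1) + arc_sum_L i t)) * h i t
      + theta * arc_sum_F i t (fun j => h j t) + e).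
Proof.
  intros Hi Hth He HA. set (A := arc_sum_F i t (fun _ => 1)) in *. set (B := arc_sum_L i t) in *.
  assert (HB0 : 0 <= B) by now apply arc_sum_L_ge0.
  pose proof hw as (Ha0 & _ & Hb0 & Ha & Hb).
  assert (HF : near k d (y t) (arc_sum_F i t (fun _ => 1))
     (fun c => sumR n (fun j => if NF t j i then a i j (x t) (y t) t * x t j c else 0))
     (arc_sum_F i t (fun j => h j t + e))).
  { unfold arc_sum_F. apply near_weaken with (v := fun c => sumR n (fun j =>
       (if NF t j i then fun c => a i j (x t) (y t) t * x t j c else fun _ => 0) c))
     (r := sumR n (fun j => if NF t j i then a i j (x t) (y t) t * (h j t + e) else 0)).
    - apply near_sum. intros j Hj. destruct (NF t j i); [|apply near_zero].
      destruct (Ha i j Hi Hj) as [_ H]. specialize (H (x t) (y t) t).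
      apply near_scal; [lra|]. now apply hull_dist_near.
    - intros c _. apply sumR_ext. intros j _. now destruct (NF t j i).
    - lra. }
  assert (HL : near k d (y t) B
     (fun c => sumR k (fun l => if NL t l i then b i l (x t) (y t) t * y t l c else 0)) 0).
  { apply near_weaken with (v := fun c => sumR k (fun l =>
       (if NL t l i then fun c => b i l (x t) (y t) t * y t l c else fun _ => 0) c))
     (r := sumR k (fun l => 0)).
    - apply near_sum. intros l Hl. destruct (NL t l i); [|apply near_zero].
      destruct (Hb i l Hi Hl) as [_ H]. specialize (H (x t) (y t) t).
      apply near_weaken with (v := fun c => b i l (x t) (y t) t * y t l c) (r := b i l (x t) (y t) t * 0); [|auto|lra].
      rewrite <- (Rmult_1_r (b i l (x t) (y t) t)) at 1.
      apply near_scal; [lra|]. now apply near_vertex.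
    - intros c _. apply sumR_ext. intros j _. now destruct (NL t j i).
    - rewrite sumR_zero; auto. lra. }
  pose proof (near_scal k d _ _ _ _ (1 - theta * (A + B)) ltac:(lra)
    (hull_dist_near k d hk (y t) (x t i) e He)) as N1.
  pose proof (near_plus _ _ _ _ _ _ _ _ _ N1 (near_scal k d _ _ _ _ theta Hth
    (near_plus _ _ _ _ _ _ _ _ _ HF HL))) as N2.
  replace ((1 - theta * (A + B)) * 1 + theta * (arc_sum_F i t (fun _ => 1) + B)) with 1 in N2
    by (fold A; ring).
  apply near_weaken with (1 := N2).
  - intros c _. unfold drift.
    rewrite (sumR_ext n (fun j => if NF t j i then a i j (x t) (y t) t * (x t j c - x t i c) else 0)
      (fun j => (if NF t j i then a i j (x t) (y t) t * x t j c else 0)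
                - x t i c * (if NF t j i then a i j (x t) (y t) t * 1 else 0)))
      by (intros j _; destruct (NF t j i); ring).
    rewrite (sumR_ext k (fun j => if NL t j i then b i j (x t) (y t) t * (y t j c - x t i c) else 0)
      (fun j => (if NL t j i then b i j (x t) (y t) t * y t j c else 0)
                - x t i c * (if NL t j i then b i j (x t) (y t) t else 0)))
      by (intros j _; destruct (NL t j i); ring).
    rewrite !sumR_minus, !sumR_scal. unfold A, B, arc_sum_F, arc_sum_L. ring.
  - assert (HFe : arc_sum_F i t (fun j => h j t + e) = arc_sum_F i t (fun j => h j t) + e * A).
    { unfold A, arc_sum_F. rewrite <- sumR_scal, <- sumR_plus. apply sumR_ext.
      intros j _. destruct (NF t j i); ring. }
    rewrite HFe. fold (h i t). assert (0 <= theta * B) by (now apply Rmult_le_pos).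
    assert (0 <= e * (theta * B)) by (apply Rmult_le_pos; lra). lra.
Qed.

(** The true increment is the Euler increment plus the integrated noise [W] plus a remainder [E],
    which is at most [eta * theta] since the drift with frozen topology is continuous along the
    trajectory. [Z] enters twice: for the noise and for the motion of the hull. *)
Lemma first_order_estimate i t tE eta :
  (i < n)%nat -> D t -> t < tE ->
  (forall s, t <= s < tE -> (forall j, NF s j i = NF t j i) /\ (forall j, NL s j i = NL t j i)) ->
  0 < eta -> exists delta, 0 < delta /\ forall theta Z, 0 < theta < delta -> t + theta < T ->
    is_RInt z t (t + theta) Z ->
    h i (t + theta) <= (1 - theta * (arc_sum_F i t (fun _ => 1) + arc_sum_L i t)) * h i t
      + theta * arc_sum_F i t (fun j => h j t) + eta * theta + 2 * Z.
Proof.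
  intros Hi Ht HtE Htop Heta.
  set (A := arc_sum_F i t (fun _ => 1) + arc_sum_L i t).
  assert (HA : 0 <= A).
  { apply Rplus_le_le_0_compat; [apply arc_sum_F_ge0; auto; intros; lra|now apply arc_sum_L_ge0]. }
  set (eta' := eta / (INR d + 1)).
  assert (Hd0 : 0 <= INR d) by apply pos_INR.
  assert (Heta' : 0 < eta') by (apply Rdiv_lt_0_compat; lra).
  assert (Hde : INR d * eta' <= eta).
  { replace eta with ((INR d + 1) * eta') by (unfold eta'; field; lra). lra. }
  set (G := fun s c => drift n k (fun _ => NF t) (fun _ => NL t) a b x y s i c).
  destruct (finite_delta d (fun c e => forall s, D s -> Rabs (s - t) < e ->
       Rabs (G s c - G t c) < eta')) as (e & He & HP).
  { intros c Hc. destruct (proj1 (cont_on_iff _ _ _) (cont_frozen_drift (NF t) (NL t) i c t Hi Hc Ht) eta' Heta')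
      as (e & He & HP).
    exists e. split; auto. intros r Hr s Hs Hst. apply HP; auto. lra. }
  exists (Rmin (Rmin (tE - t) e) (/ (A + 1))). split.
  { apply Rmin_pos; [apply Rmin_pos; lra|]. apply Rinv_0_lt_compat. lra. }
  intros theta Z Hth HthT HZ.
  pose proof (Rmin_l (Rmin (tE - t) e) (/ (A + 1))). pose proof (Rmin_r (Rmin (tE - t) e) (/ (A + 1))).
  pose proof (Rmin_l (tE - t) e). pose proof (Rmin_r (tE - t) e).
  assert (HthA : theta * A <= 1).
  { apply Rle_trans with (/ (A + 1) * A); [apply Rmult_le_compat_r; lra|].
    apply Rmult_le_reg_l with (A + 1); [lra|]. replace ((A + 1) * (/ (A + 1) * A)) with A by (field; lra). lra. }
  destruct Ht as [Ht0 HtT].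
  set (W := fun c => RInt (fun s => w i s c) t (t + theta)).
  assert (HW : forall c, (c < d)%nat -> is_RInt (fun s => w i s c) t (t + theta) (W c)).
  { intros c Hc. apply (RInt_correct (V := R_CompleteNormedModule)), (ex_RInt_continuous (V := R_CompleteNormedModule)). intros s _.
    apply continuity_pt_filterlim. now apply hadm. }
  assert (HWn : norm_d d W <= Z).
  { apply (norm_integral_le d (fun s => w i s) W z Z t (t + theta)); auto; [lra|].
    intros s _. now apply noise_le_znorm. }
  set (E := fun c => x (t + theta) i c - (x t i c + theta * drift n k NF NL a b x y t i c) - W c).
  assert (HE : forall c, (c < d)%nat -> Rabs (E c) <= eta' * theta).
  { intros c Hc.
    assert (HI : is_RInt (fun s => G s c - G t c) t (t + theta) (E c)).
    { apply is_RInt_ext with (fun s => minus (minus (rhsF n k NF NL a b w x y s i c) (w i s c)) (G t c)).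
      - rewrite Rmin_left, Rmax_right by lra. intros s Hs.
        unfold minus, plus, opp; simpl. unfold rhsF, G, drift.
        destruct (Htop s ltac:(lra)) as [HF HL].
        rewrite (sumR_ext n (fun j => if NF s j i then _ else 0)
          (fun j => if NF t j i then a i j (x s) (y s) s * (x s j c - x s i c) else 0))
          by (intros j _; now rewrite HF).
        rewrite (sumR_ext k (fun j => if NL s j i then _ else 0)
          (fun j => if NL t j i then b i j (x s) (y s) s * (y s j c - x s i c) else 0))
          by (intros j _; now rewrite HL). ring.
      - replace (E c) with (minus (minus (x (t + theta) i c - x t i c) (W c)) (theta * G t c)).
        + apply (is_RInt_minus (V := R_NormedModule)); [apply (is_RInt_minus (V := R_NormedModule))|].
          * now apply primitive_follower; [..|lra|lra|].
          * now apply HW.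
          * apply is_RInt_cst. ring.
        + unfold E, minus, plus, opp; simpl. unfold G, drift. ring. }
    assert (HG : forall s, t < s < t + theta -> Rabs (G s c - G t c) < eta').
    { intros s Hs. apply HP; auto; [unfold D; lra|]. rewrite Rabs_right; lra. }
    apply Rabs_le. split.
    - apply (is_RInt_le (fun _ => - eta') (fun s => G s c - G t c) t (t + theta)); auto; [lra|apply is_RInt_cst; ring|].
      intros s Hs. apply Rlt_le. apply (Rabs_def2 _ _ (HG s Hs)).
    - apply (is_RInt_le (fun s => G s c - G t c) (fun _ => eta') t (t + theta)); auto; [lra|apply is_RInt_cst; ring|].
      intros s Hs. apply Rlt_le. apply (Rabs_def2 _ _ (HG s Hs)). }
  assert (HEn : norm_d d E <= eta * theta).
  { eapply Rle_trans; [apply norm_le_sum|].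
    apply Rle_trans with (sumR d (fun _ => eta' * theta)); [now apply sumR_le|].
    rewrite sumR_const, <- Rmult_assoc. apply Rmult_le_compat_r; lra. }
  apply Rle_plus_epsilon. intros eps Heps.
  apply Rle_trans with ((1 - theta * A) * h i t + theta * arc_sum_F i t (fun j => h j t) + eps
    + (eta * theta + Z) + Z); [|lra].
  apply hull_dist_le_near; auto. apply near_move with (y t).
  { intros l Hl. apply leader_displacement; auto; lra. }
  apply near_perturb with (fun c => x t i c + theta * drift n k NF NL a b x y t i c).
  { apply near_averaged; auto. lra. }
  apply Rle_trans with (norm_d d E + norm_d d W); [|lra].
  eapply Rle_trans; [|apply norm_triang]. apply Req_le, norm_ext. intros c _. unfold E. ring.
Qed.

(** * Removing the accumulated input, and decay while the topology is constant *)

Variable ts : R.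
Hypothesis hts : 0 <= ts < T.
Hypothesis hz : ex_RInt z 0 ts.

(** The factor 2 matches the term [2 * Z] of [first_order_estimate], so the input cancels from the
    differential inequality for $h_i - N$. *)
Let N t := 2 * RInt z 0 t.

Lemma z_integrable t1 t2 : 0 <= t1 <= t2 -> t2 <= ts -> ex_RInt z t1 t2.
Proof.
  intros H1 H2. apply (ex_RInt_Chasles_2 (V := R_CompleteNormedModule)) with 0; [lra|].
  apply (ex_RInt_Chasles_1 (V := R_CompleteNormedModule)) with ts; [lra|auto].
Qed.

Lemma N_incr t1 t2 : 0 <= t1 <= t2 -> t2 <= ts -> N t2 = N t1 + 2 * RInt z t1 t2.
Proof.
  intros H1 H2. unfold N.
  pose proof (RInt_Chasles z 0 t1 t2 (z_integrable 0 t1 ltac:(lra) ltac:(lra))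
    (z_integrable t1 t2 ltac:(lra) ltac:(lra))) as H. unfold plus in H; simpl in H. lra.
Qed.

Lemma z_int_ge0 t1 t2 : 0 <= t1 <= t2 -> t2 <= ts -> 0 <= RInt z t1 t2.
Proof.
  intros H1 H2. apply RInt_ge_0; [lra|now apply z_integrable|]. intros; apply z_ge0.
Qed.

Lemma N_ge0 t : 0 <= t <= ts -> 0 <= N t.
Proof. intros Ht. unfold N. pose proof (z_int_ge0 0 t). lra. Qed.

Lemma cont_N t1 t2 t : 0 <= t1 <= t2 -> t2 <= ts -> t1 <= t <= t2 -> cont_on (fun s => t1 <= s <= t2) N t.
Proof.
  intros H1 H2 Ht. destruct (ex_RInt_ub z 0 ts hz) as [M HM].
  rewrite Rmin_left, Rmax_right in HM by lra.
  set (M' := Rmax 1 M). assert (HM1 : 1 <= M') by apply Rmax_l.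
  assert (HM2 : forall s, 0 <= s <= ts -> z s <= M').
  { intros s Hs. eapply Rle_trans; [apply Rle_abs|]. eapply Rle_trans; [apply (HM s Hs)|apply Rmax_r]. }
  assert (HL : forall s1 s2, 0 <= s1 <= s2 -> s2 <= ts -> 0 <= N s2 - N s1 <= 2 * M' * (s2 - s1)).
  { intros s1 s2 Hs1 Hs2. rewrite (N_incr s1 s2) by auto. pose proof (z_int_ge0 s1 s2 Hs1 Hs2).
    enough (RInt z s1 s2 <= (s2 - s1) * M') by lra.
    apply (is_RInt_le z (fun _ => M') s1 s2); [lra| |now apply is_RInt_cst|].
    - apply (RInt_correct z). now apply z_integrable.
    - intros s Hs. apply HM2. lra. }
  apply cont_on_iff. intros eps He. exists (eps / (2 * M')). split; [apply Rdiv_lt_0_compat; lra|].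
  intros s Hs Hst. assert (Hq : 2 * M' * (eps / (2 * M')) = eps) by (field; lra).
  assert (2 * M' * Rabs (s - t) < eps) by (rewrite <- Hq; apply Rmult_lt_compat_l; lra).
  destruct (Rle_lt_dec t s) as [Hle|Hlt].
  - rewrite (Rabs_right (s - t)) in * by lra. pose proof (HL t s ltac:(lra) ltac:(lra)).
    rewrite Rabs_right; lra.
  - rewrite (Rabs_left (s - t)) in * by lra. pose proof (HL s t ltac:(lra) ltac:(lra)).
    rewrite Rabs_minus_sym, Rabs_right; lra.
Qed.

(** Put $g = h_i - N - m$. In-neighbours satisfy $h_j \le m + N = h_i - g$, so a follower arc
    contributes at most $-a_{ij} g$ to the growth of $h_i$; a leader arc contributes $-b_{il} h_i
    \le -b_{il} g$. One arc thus gives the rate [c], and the case [c = 0] gives monotonicity without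
    any arc. *)
Lemma decay_on_piece i t1 t2 m c :
  (i < n)%nat -> 0 <= t1 <= t2 -> t2 <= ts -> 0 <= m -> 0 <= c ->
  (forall s, t1 <= s < t2 -> (forall j, NF s j i = NF t1 j i) /\ (forall j, NL s j i = NL t1 j i)) ->
  (forall s j, t1 <= s < t2 -> (j < n)%nat -> NF s j i = true -> h j s <= m + N s) ->
  (c = 0 \/ (c <= alo /\ c <= blo /\
     ((exists j, (j < n)%nat /\ NF t1 j i = true) \/ (exists l, (l < k)%nat /\ NL t1 l i = true)))) ->
  Rmax 0 (h i t2 - N t2 - m) <= exp (- c * (t2 - t1)) * Rmax 0 (h i t1 - N t1 - m).
Proof.
  intros Hi H1 H2 Hm Hc Htop Hnb Harc.
  apply (dini_decay (fun s => h i s - N s - m)); [lra|auto| |].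
  - intros t Ht.
    assert (FF : Filter (within (fun s => t1 <= s <= t2) (locally t))) by typeclasses eauto.
    unfold cont_on. apply cont_at_minus; [auto|apply cont_at_minus; auto|now apply cont_at_const].
    + apply cont_on_sub with D; [unfold D; intros; lra|]. apply cont_dist; auto. unfold D; lra.
    + now apply cont_N.
  - intros t Ht Hg eta Heta.
    destruct (first_order_estimate i t t2 eta) as (delta & Hd & Hest); auto; try (unfold D; lra).
    { intros s Hs. destruct (Htop s ltac:(lra)) as [E1 E2]. destruct (Htop t ltac:(lra)) as [E3 E4].
      split; intros j; [now rewrite E1|now rewrite E2]. }
    exists delta. split; auto. intros theta Hth Hth2.
    specialize (Hest theta (RInt z t (t + theta)) Hth ltac:(lra)
      (RInt_correct z _ _ (z_integrable t (t + theta) ltac:(lra) ltac:(lra)))).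
    rewrite (N_incr t (t + theta)) by lra.
    set (g := h i t - N t - m) in *. pose proof (N_ge0 t ltac:(lra)) as HN.
    assert (HF : arc_sum_F i t (fun j => h j t) <= arc_sum_F i t (fun _ => 1) * (h i t - g)).
    { unfold arc_sum_F. rewrite Rmult_comm, <- sumR_scal. apply sumR_le. intros j Hj.
      destruct (NF t j i) eqn:E; [|lra].
      destruct hw as (Ha0 & _ & _ & Ha & _). destruct (Ha i j Hi Hj) as [_ H]. specialize (H (x t) (y t) t).
      specialize (Hnb t j ltac:(lra) Hj E).
      replace ((h i t - g) * (a i j (x t) (y t) t * 1)) with (a i j (x t) (y t) t * (h i t - g)) by ring.
      apply Rmult_le_compat_l; [lra|]. unfold g. lra. }
    pose proof (arc_sum_F_ge0 i t (fun _ => 1) Hi ltac:(intros; lra)) as HA0.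
    pose proof (arc_sum_L_ge0 i t Hi) as HB0.
    set (A := arc_sum_F i t (fun _ => 1)) in *. set (B := arc_sum_L i t) in *.
    assert (HcA : c <= A + B).
    { destruct Harc as [->|(Hca & Hcb & [(j & Hj & E)|(l & Hl & E)])]; [lra| |].
      - rewrite <- (proj1 (Htop t ltac:(lra))) in E.
        destruct hw as (Ha0 & _ & _ & Ha & _).
        assert (a i j (x t) (y t) t * 1 <= A).
        { unfold A, arc_sum_F.
          pose proof (sumR_term_le n (fun j => if NF t j i then a i j (x t) (y t) t * 1 else 0) j) as H.
          simpl in H. rewrite E in H. apply H; auto. intros j' Hj'. destruct (NF t j' i); [|lra].
          destruct (Ha i j' Hi Hj') as [_ H']. specialize (H' (x t) (y t) t). lra. }
        destruct (Ha i j Hi Hj) as [_ H']. specialize (H' (x t) (y t) t). lra.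
      - rewrite <- (proj2 (Htop t ltac:(lra))) in E.
        destruct hw as (_ & _ & Hb0 & _ & Hb).
        assert (b i l (x t) (y t) t <= B).
        { unfold B, arc_sum_L.
          pose proof (sumR_term_le k (fun j => if NL t j i then b i j (x t) (y t) t else 0) l) as H.
          simpl in H. rewrite E in H. apply H; auto. intros j' Hj'. destruct (NL t j' i); [|lra].
          destruct (Hb i j' Hi Hj') as [_ H']. specialize (H' (x t) (y t) t). lra. }
        destruct (Hb i l Hi Hl) as [_ H']. specialize (H' (x t) (y t) t). lra. }
    assert (Hhg : g <= h i t) by (unfold g; lra).
    assert (X1 : theta * arc_sum_F i t (fun j => h j t) <= theta * (A * (h i t - g)))
      by (apply Rmult_le_compat_l; lra).
    (* Here [h i t - g] is [N t + m], which is nonnegative. *)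
    assert (X2 : 0 <= theta * B * (h i t - g)) by (apply Rmult_le_pos; [apply Rmult_le_pos|]; lra).
    assert (X3 : 0 <= theta * g * (A + B - c)) by (apply Rmult_le_pos; [apply Rmult_le_pos|]; lra).
    unfold g in *. lra.
Qed.

End Trajectory.

(** * JLC implies SiISS *)

Lemma dist_max_ge n k d y x i : (i < n)%nat -> hull_dist k d y (x i) <= dist_max n k d y x.
Proof.
  intros Hi. unfold dist_max.
  assert (Hin : In i (seq 0 n)) by (apply in_seq; lia).
  induction (seq 0 n) as [|j l IH]; simpl; [contradiction|].
  destruct Hin as [->|Hin]; [apply Rmax_l|].
  eapply Rle_trans; [now apply IH|apply Rmax_r].
Qed.

Lemma dist_max_le n k d y x r : 0 <= r ->
  (forall i, (i < n)%nat -> hull_dist k d y (x i) <= r) -> dist_max n k d y x <= r.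
Proof.
  intros Hr H. unfold dist_max.
  assert (Hin : forall i, In i (seq 0 n) -> (i < n)%nat) by (intros i Hi; apply in_seq in Hi; lia).
  induction (seq 0 n) as [|j l IH]; simpl; auto.
  apply Rmax_lub; [apply H, Hin; now left|]. apply IH. intros i Hi. apply Hin. now right.
Qed.

Lemma dist_max_ge0 n k d y x : 0 <= dist_max n k d y x.
Proof.
  unfold dist_max. induction (seq 0 n) as [|j l IH]; simpl; [lra|].
  eapply Rle_trans; [exact IH|apply Rmax_r].
Qed.

(** Walking backwards along arcs, [l] collects the vertices already visited, all reachable from the
    current one. Acyclicity keeps the current vertex out of [l], so the number [m] of remaining
    vertices decreases and the walk stops after at most [n] steps. *)
Lemma acyclic_ind n NF (P : nat -> Prop) :
  joint_follower_acyclic n NF ->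
  (forall i, (i < n)%nat -> (forall j, joint_F n NF 0 j i -> P j) -> P i) ->
  forall i, (i < n)%nat -> P i.
Proof.
  intros Hac Hstep.
  enough (H : forall m i l, (length l + m = n)%nat -> NoDup l ->
    (forall j, In j l -> (j < n)%nat /\ clos_trans nat (joint_F n NF 0) i j) -> (i < n)%nat -> P i).
  { intros i Hi. apply (H n i nil); auto; [constructor|]. intros j []. }
  induction m; intros i l Hlen Hnd Hl Hi.
  all: assert (Hni : ~ In i l) by (intros Hin; apply (Hac i Hi), (Hl i Hin)).
  - exfalso. assert (Hlen' : (length (i :: l) <= length (seq 0 n))%nat).
    { apply NoDup_incl_length; [now constructor|]. intros j [<-|Hj]; apply in_seq; [lia|].
      destruct (Hl j Hj). lia. }
    rewrite length_seq in Hlen'. simpl in Hlen'. lia.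
  - apply Hstep; auto. intros j Hj. apply (IHm j (i :: l)); [simpl; lia|now constructor| |apply Hj].
    intros q [<-|Hq]; [split; [auto|now apply t_step]|].
    destruct (Hl q Hq). split; auto. apply t_trans with i; [now apply t_step|auto].
Qed.

Section Decay.
Variables (n k d : nat) (NF NL : R -> nat -> nat -> bool).
Variables (a b : nat -> nat -> State -> State -> R -> R) (alo ahi blo : R).
Hypothesis hk : (1 <= k)%nat.
Hypothesis hw : weights_ok n k d a b alo ahi blo.
Variables (tauD : R) (sw : nat -> R).
Hypothesis htau : 0 < tauD.
Hypothesis hsw0 : sw O = 0.
Hypothesis hdwell : forall m, sw m + tauD <= sw (S m).
Hypothesis hpiece : forall m t, sw m <= t < sw (S m) ->
  (forall j i, NF t j i = NF (sw m) j i) /\ (forall j i, NL t j i = NL (sw m) j i).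

Lemma switch_ge m : INR m * tauD <= sw m.
Proof.
  induction m; [rewrite hsw0; simpl; lra|]. rewrite S_INR. specialize (hdwell m). lra.
Qed.

Lemma switch_le p q : (p <= q)%nat -> sw p <= sw q.
Proof. induction 1; [lra|]. specialize (hdwell m). lra. Qed.

Lemma switch_beyond t : exists m, t <= sw m.
Proof.
  destruct (INR_unbounded (t / tauD)) as [m Hm]. exists m.
  pose proof (switch_ge m).
  assert (t / tauD * tauD <= INR m * tauD) by (apply Rmult_le_compat_r; lra).
  replace (t / tauD * tauD) with t in H0 by (field; lra). lra.
Qed.

Lemma piece_containing p t : sw p <= t -> exists q, (p <= q)%nat /\ sw q <= t < sw (S q).
Proof.
  intros Hp. destruct (switch_beyond (t + 1)) as [m Hm].
  assert (H : forall r, (p <= r)%nat -> t < sw r -> exists q, (p <= q)%nat /\ sw q <= t < sw (S q)).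
  { induction r; intros Hr Ht; [replace p with O in Hp by lia; lra|].
    destruct (Rle_lt_dec (sw r) t) as [Hle|Hlt].
    - destruct (Nat.eq_dec p (S r)) as [->|]; [lra|]. exists r. split; [lia|lra].
    - apply IHr; auto. destruct (Nat.eq_dec p (S r)) as [->|]; [|lia].
      pose proof (hdwell r). lra. }
  apply (H m); [|lra]. destruct (Nat.le_gt_cases p m) as [|Hlt]; auto.
  pose proof (switch_le m p ltac:(lia)). lra.
Qed.

Definition integrated_input (u : nat -> State -> R -> Vec) w y t := 2 * RInt (znorm n k d u w y) 0 t.

Definition excess u w (x y : R -> State) i m t : R :=
  Rmax 0 (hull_dist k d (y t) (x t i) - integrated_input u w y t - m).

Definition neighbours_below u w (x y : R -> State) i m t1 t2 : Prop :=
  forall s j, t1 <= s < t2 -> (j < n)%nat -> NF s j i = true ->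
    hull_dist k d (y s) (x s j) <= m + integrated_input u w y s.

(** The piecewise estimate with rate 0 is chained across the switching instants between [t1] and
    [t2]. *)
Lemma excess_monotone u w T x y i m t1 t2 :
  admissible n k d u w -> solves n k d NF NL a b u w T x y ->
  (i < n)%nat -> 0 <= t1 <= t2 -> t2 < T -> ex_RInt (znorm n k d u w y) 0 t2 -> 0 <= m ->
  neighbours_below u w x y i m t1 t2 ->
  excess u w x y i m t2 <= excess u w x y i m t1.
Proof.
  intros Hadm Hsol Hi Ht HT Hz Hm Hnb.
  enough (H : forall q t2', t1 <= t2' <= t2 -> t2' <= sw q ->
    excess u w x y i m t2' <= excess u w x y i m t1).
  { destruct (switch_beyond t2) as [q Hq]. apply (H q); auto. lra. }
  assert (Hpc : forall q t1' t2', sw q <= t1' <= t2' -> t1 <= t1' -> t2' <= t2 -> t2' <= sw (S q) ->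
    excess u w x y i m t2' <= excess u w x y i m t1').
  { intros q t1' t2' H1 H2 H3 H4.
    replace (excess u w x y i m t1') with (exp (- 0 * (t2' - t1')) * excess u w x y i m t1')
      by (rewrite Ropp_0, Rmult_0_l, exp_0; ring).
    unfold excess, integrated_input.
    apply (decay_on_piece n k d NF NL a b alo ahi blo hk hw u w T x y Hadm Hsol t2); auto; try lra.
    - intros s Hs. destruct (hpiece q s ltac:(lra)) as [E1 E2].
      destruct (hpiece q t1' ltac:(lra)) as [E3 E4].
      split; intros j; [now rewrite E1, E3|now rewrite E2, E4].
    - intros s j Hs Hj HE. apply Hnb; auto. lra. }
  induction q; intros t2' H1 H2.
  - pose proof hsw0. replace t2' with t1 by lra. lra.
  - destruct (Rle_lt_dec t2' (sw q)) as [Hle|Hlt]; [now apply IHq|].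
    destruct (Rle_lt_dec (sw q) t1) as [Hle1|Hlt1].
    + apply (Hpc q); lra.
    + apply Rle_trans with (excess u w x y i m (sw q)); [apply (Hpc q); lra|apply IHq; lra].
Qed.

Definition has_arc_into i r : Prop :=
  (exists j, (j < n)%nat /\ NF r j i = true) \/ (exists l, (l < k)%nat /\ NL r l i = true).

(** Each further factor comes from one complete piece on which an arc enters [i]: its length is at
    least [tauD]. The time [t1] is chosen before the trajectory, so it is uniform in inputs and
    initial states. *)
Lemma excess_geometric i : (i < n)%nat ->
  (forall t, 0 <= t -> exists r, t <= r /\ has_arc_into i r) ->
  forall K t0, 0 <= t0 -> exists t1, t0 <= t1 /\
  forall u w T x y m t,
    admissible n k d u w -> solves n k d NF NL a b u w T x y ->
    t1 <= t < T -> ex_RInt (znorm n k d u w y) 0 t -> 0 <= m ->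
    neighbours_below u w x y i m t0 t ->
    excess u w x y i m t <= (exp (- Rmin alo blo * tauD))^K * excess u w x y i m t0.
Proof.
  intros Hi Harc K t0 Ht0. induction K as [|K (t1 & Ht1 & IH)].
  - exists t0. split; [lra|]. intros u w T x y m t Hadm Hsol Ht Hz Hm Hnb.
    rewrite pow_O, Rmult_1_l. apply excess_monotone with T; auto; lra.
  - destruct (switch_beyond t1) as [q0 Hq0].
    (* The arc is sought after the switching instant [sw q0], so that the whole piece containing it
       lies after [t1]. *)
    destruct (Harc (sw q0) ltac:(lra)) as (r & Hr & Hin).
    destruct (piece_containing q0 r Hr) as (q & Hq & Hrq).
    pose proof (switch_le q0 q Hq) as Hq0q. pose proof (hdwell q) as Hdw.
    exists (sw (S q)). split; [lra|]. intros u w T x y m t Hadm Hsol Ht Hz Hm Hnb.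
    assert (Hzs : forall t', 0 <= t' <= t -> ex_RInt (znorm n k d u w y) 0 t').
    { intros t' Ht'. apply (ex_RInt_Chasles_1 (V := R_CompleteNormedModule)) with t; auto. }
    assert (Hnbs : forall t1' t2', t0 <= t1' -> t2' <= t -> neighbours_below u w x y i m t1' t2').
    { intros t1' t2' H1 H2 s j Hs Hj HE. apply Hnb; auto. lra. }
    apply Rle_trans with (excess u w x y i m (sw (S q))).
    { apply excess_monotone with T; auto; try lra. apply Hnbs; lra. }
    pose proof hw as (Ha0 & _ & Hb0 & _). pose proof (Rmin_pos _ _ Ha0 Hb0).
    set (c := Rmin alo blo) in *.
    assert (He0 : 0 <= excess u w x y i m (sw q)) by apply Rmax_l.
    apply Rle_trans with (exp (- c * tauD) * excess u w x y i m (sw q)).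
    + apply Rle_trans with (exp (- c * (sw (S q) - sw q)) * excess u w x y i m (sw q)).
      * apply (decay_on_piece n k d NF NL a b alo ahi blo hk hw u w T x y Hadm Hsol t); auto; try lra.
        -- intros s Hs. destruct (hpiece q s ltac:(lra)) as [E1 E2].
           split; intros j; [now rewrite E1|now rewrite E2].
        -- apply Hnbs; lra.
        -- right. split; [apply Rmin_l|]. split; [apply Rmin_r|].
           destruct (hpiece q r Hrq) as [E1 E2].
           destruct Hin as [(j & Hj & E)|(l & Hl & E)]; [left; exists j; now rewrite <- E1|].
           right; exists l; now rewrite <- E2.
      * apply Rmult_le_compat_r; auto.
        assert (Hle : - c * (sw (S q) - sw q) <= - c * tauD) by nra.
        destruct Hle as [Hlt|Heq]; [left; now apply exp_increasing|right; now rewrite Heq].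
    + rewrite <- tech_pow_Rmult, Rmult_assoc. apply Rmult_le_compat_l; [left; apply exp_pos|].
      apply IH with T; auto; try lra. { apply Hzs. lra. } apply Hnbs; lra.
Qed.

(** The quantifiers over inputs and solutions come after [tau]; this uniformity is what permits a
    single class-$\mathcal{KL}$ function. *)
Definition attenuated eps i tau : Prop :=
  forall u w T x y t, admissible n k d u w -> solves n k d NF NL a b u w T x y ->
    0 <= t < T -> tau <= t -> ex_RInt (znorm n k d u w y) 0 t ->
    hull_dist k d (y t) (x t i) <= eps * dist_max n k d (y 0) (x 0) + integrated_input u w y t.

(** Induction along in-neighbours. With [m] the initial distance the excess starts at 0 and stays
    there. For small [eps], the neighbours are first attenuated to [eps / 2] after [t0]; then [m] is
    [eps / 2] times the initial distance, and [K] geometric factors bring the excess below the other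
    half. *)
Lemma attenuation : joint_follower_acyclic n NF -> JLC n k NF NL ->
  forall i, (i < n)%nat ->
    attenuated 1 i 0 /\ forall eps, 0 < eps -> exists tau, forall tau', tau <= tau' -> attenuated eps i tau'.
Proof.
  intros Hac Hjlc. apply (acyclic_ind n NF); auto. intros i Hi IH.
  assert (Harc : forall t, 0 <= t -> exists r, t <= r /\ has_arc_into i r).
  { intros t Ht. destruct (Hjlc t Ht i Hi) as (l & j & Hl & Hj & (r & Hr & E) & Hpath).
    (* The last arc of the path from a leader enters [i]: it is the leader arc itself if the
       follower path is empty, and a follower arc otherwise. *)
    apply clos_rt_rtn1 in Hpath. destruct Hpath as [|j' i' (H1 & H2 & r' & H3 & H4) _].
    - exists r. split; auto. right. now exists l.
    - exists r'. split; auto. left. now exists j'. }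
  assert (Hin : forall s j, 0 <= s -> (j < n)%nat -> NF s j i = true -> joint_F n NF 0 j i).
  { intros s j Hs Hj E. split; auto. split; auto. now exists s. }
  assert (Hone : attenuated 1 i 0).
  { intros u w T x y t Hadm Hsol Ht _ Hz. set (M := dist_max n k d (y 0) (x 0)).
    pose proof (dist_max_ge0 n k d (y 0) (x 0)) as HM. fold M in HM.
    pose proof (excess_monotone u w T x y i M 0 t Hadm Hsol Hi ltac:(lra) ltac:(lra) Hz HM) as H.
    unfold excess in H. unfold integrated_input in H at 2.
    rewrite RInt_point in H. unfold zero in H; simpl in H.
    pose proof (dist_max_ge n k d (y 0) (x 0) i Hi) as HMi. fold M in HMi.
    rewrite (Rmax_left 0 (hull_dist k d (y 0) (x 0 i) - _ - _)) in H by lra.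
    enough (hull_dist k d (y t) (x t i) - integrated_input u w y t - M <= 0) by lra.
    eapply Rle_trans; [apply (Rmax_r 0)|apply H]. intros s j Hs Hj E.
    destruct (IH j (Hin s j ltac:(lra) Hj E)) as [Hj1 _]. rewrite <- (Rmult_1_l M).
    apply Hj1 with T; auto; try lra.
    apply (ex_RInt_Chasles_1 (V := R_CompleteNormedModule)) with t; auto; lra. }
  split; auto. intros eps Heps.
  destruct (finite_threshold n (fun j tau => joint_F n NF 0 j i -> attenuated (eps / 2) j tau)) as (t0 & Ht0 & Hatt).
  { intros j Hj. destruct (classic (joint_F n NF 0 j i)) as [HJ|HJ].
    - destruct (IH j HJ) as [_ H]. destruct (H (eps / 2) ltac:(lra)) as [tau Htau]. exists tau. auto.
    - exists 0. intros; contradiction. }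
  pose proof hw as (Ha0 & _ & Hb0 & _). pose proof (Rmin_pos _ _ Ha0 Hb0) as Hc.
  assert (Hq : 0 < Rmin alo blo * tauD) by now apply Rmult_lt_0_compat.
  assert (Hq1 : exp (- Rmin alo blo * tauD) < 1) by (rewrite <- exp_0; apply exp_increasing; lra).
  destruct (pow_lt_1_zero (exp (- Rmin alo blo * tauD)) ltac:(rewrite Rabs_right; [auto|left; apply exp_pos])
    (eps / 2) ltac:(lra)) as [K HK].
  specialize (HK K (le_n K)). rewrite Rabs_right in HK by (left; apply pow_lt, exp_pos).
  destruct (excess_geometric i Hi Harc K t0 Ht0) as (t1 & Ht1 & Hgeo).
  exists t1. intros tau' Htau' u w T x y t Hadm Hsol Ht Htt Hz.
  set (M := dist_max n k d (y 0) (x 0)).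
  pose proof (dist_max_ge0 n k d (y 0) (x 0)) as HM. fold M in HM.
  assert (HM2 : 0 <= eps / 2 * M) by (apply Rmult_le_pos; lra).
  assert (Hzs : forall s, 0 <= s <= t -> ex_RInt (znorm n k d u w y) 0 s).
  { intros s Hs. apply (ex_RInt_Chasles_1 (V := R_CompleteNormedModule)) with t; auto. }
  assert (Hg : excess u w x y i (eps / 2 * M) t
     <= (exp (- Rmin alo blo * tauD))^K * excess u w x y i (eps / 2 * M) t0).
  { apply Hgeo with T; auto; [lra|]. intros s j Hs Hj E.
    apply (Hatt j Hj t0 ltac:(lra) (Hin s j ltac:(lra) Hj E) u w T x y s); auto; try lra.
    apply Hzs; lra. }
  assert (H0 : excess u w x y i (eps / 2 * M) t0 <= M).
  { unfold excess. apply Rmax_lub; auto.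
    pose proof (Hone u w T x y t0 Hadm Hsol ltac:(lra) Ht0 (Hzs t0 ltac:(lra))). fold M in H. lra. }
  assert (H1 : (exp (- Rmin alo blo * tauD))^K * excess u w x y i (eps / 2 * M) t0 <= eps / 2 * M).
  { apply Rmult_le_compat; auto; [left; apply pow_lt, exp_pos|apply Rmax_l|lra]. }
  pose proof (Rmax_r 0 (hull_dist k d (y t) (x t i) - integrated_input u w y t - eps / 2 * M)) as H2.
  unfold excess in Hg at 1. lra.
Qed.

(** The best uniform attenuation factor [phi t] is nonincreasing and tends to 0, so it supplies the
    decay of $\beta$, which is linear in the initial distance. *)
Theorem JLC_SiISS : joint_follower_acyclic n NF -> JLC n k NF NL -> SiISS n k d NF NL a b.
Proof.
  intros Hac Hjlc. pose proof (attenuation Hac Hjlc) as Hatt.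
  set (Sat := fun t e => 0 <= e /\ forall i, (i < n)%nat -> attenuated e i t).
  assert (Hmono : forall t1 t2 e, t1 <= t2 -> Sat t1 e -> Sat t2 e).
  { intros t1 t2 e H12 [H1 H2]. split; auto. intros i Hi u w T x y t Hadm Hsol Ht Htt Hz.
    apply (H2 i Hi u w T); auto. lra. }
  assert (Hinf : forall t, 0 <= t -> exists r, is_inf (Sat t) r).
  { intros t Ht. apply is_inf_exists with 0; [|intros s [Hs _]; auto].
    exists 1. apply Hmono with 0; auto. split; [lra|]. intros i Hi. now apply Hatt. }
  set (phi := fun t => epsilon (inhabits 0) (is_inf (Sat t))).
  assert (Hphi : forall t, 0 <= t -> is_inf (Sat t) (phi t)).
  { intros t Ht. apply epsilon_spec. auto. }
  assert (Hphi0 : forall t, 0 <= t -> 0 <= phi t).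
  { intros t Ht. apply (Hphi t Ht). intros s [Hs _]; auto. }
  assert (Hinv : forall t, 0 <= t -> 0 < / (1 + t)) by (intros; apply Rinv_0_lt_compat; lra).
  (* The summand [/ (1 + t)] keeps $\beta(\cdot,t)$ strictly increasing even where [phi t] is 0. The
     gain [2 * r] reproduces [integrated_input]. *)
  exists (fun r t => r * (phi t + / (1 + t))), (fun r => 2 * r). split; [|split].
  - split.
    + intros t Ht. specialize (Hphi0 t Ht). specialize (Hinv t Ht).
      set (p := phi t + / (1 + t)). assert (Hp : 0 < p) by (unfold p; lra).
      split; [ring|split].
      * intros r eps Hr He. exists (eps / p). split; [now apply Rdiv_lt_0_compat|].
        intros r' Hr' Hd. replace (r' * p - r * p) with ((r' - r) * p) by ring.
        rewrite Rabs_mult, (Rabs_right p) by lra.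
        replace eps with (eps / p * p) by (field; lra). now apply Rmult_lt_compat_r.
      * intros r s Hr Hrs. now apply Rmult_lt_compat_r.
    + intros r Hr. split.
      * intros t1 t2 H1 H12. apply Rmult_le_compat_l; auto. apply Rplus_le_compat.
        -- apply (Hphi t1 H1). intros s Hs. apply (Hphi t2 ltac:(lra)). now apply Hmono with t1.
        -- apply Rinv_le_contravar; lra.
      * intros eps He. set (e := eps / (2 * (r + 1))).
        assert (He' : 0 < e) by (apply Rdiv_lt_0_compat; lra).
        destruct (finite_threshold n (fun i tau => attenuated e i tau)) as (t0 & Ht0 & H0).
        { intros i Hi. now apply Hatt. }
        exists (Rmax t0 (/ e)). intros t Ht. pose proof (Rmax_l t0 (/ e)). pose proof (Rmax_r t0 (/ e)).
        assert (Hp1 : phi t <= e).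
        { apply (Hphi t ltac:(lra)). split; [lra|]. intros i Hi. apply H0; auto. lra. }
        assert (Hp2 : / (1 + t) <= e).
        { rewrite <- (Rinv_inv e). apply Rinv_le_contravar; [now apply Rinv_0_lt_compat|lra]. }
        apply Rle_lt_trans with (r * (2 * e)); [apply Rmult_le_compat_l; lra|].
        replace eps with ((r + 1) * (2 * e)) by (unfold e; field; lra).
        apply Rmult_lt_compat_r; lra.
  - split; [ring|split; [|intros; lra]]. intros r eps Hr He. exists (eps / 2). split; [lra|].
    intros r' Hr' Hd. replace (2 * r' - 2 * r) with (2 * (r' - r)) by ring.
    rewrite Rabs_mult, (Rabs_right 2) by lra. lra.
  - intros u w Hadm T x y HT Hsol t Ht pr. rewrite <- RInt_Reals.
    set (M := dist_max n k d (y 0) (x 0)).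
    pose proof (dist_max_ge0 n k d (y 0) (x 0)) as HM. fold M in HM.
    assert (Hz : ex_RInt (znorm n k d u w y) 0 t).
    { apply ex_RInt_ext with (fun s => scal (/ 2) (2 * znorm n k d u w y s)).
      - intros s _. unfold scal; simpl; unfold mult; simpl. field.
      - apply (ex_RInt_scal (V := R_NormedModule)). now apply ex_RInt_Reals_1. }
    assert (HN : RInt (fun s => 2 * znorm n k d u w y s) 0 t = integrated_input u w y t).
    { exact (RInt_scal (V := R_CompleteNormedModule) _ 0 t 2 Hz). }
    rewrite HN.
    assert (HN0 : 0 <= integrated_input u w y t).
    { unfold integrated_input. apply Rmult_le_pos; [lra|].
      apply RInt_ge_0; [lra|auto|]. intros s _. apply sqrt_pos. }
    specialize (Hphi t ltac:(lra)). specialize (Hphi0 t ltac:(lra)). specialize (Hinv t ltac:(lra)).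
    assert (0 <= M * / (1 + t)) by (apply Rmult_le_pos; lra).
    assert (0 <= M * phi t) by (apply Rmult_le_pos; lra).
    apply dist_max_le; [lra|]. intros i Hi.
    enough (hull_dist k d (y t) (x t i) - integrated_input u w y t <= M * phi t) by lra.
    (* For positive [M] the bound is divided by [M] to compare with the infimum [phi t]; for [M = 0]
       the attenuation factor 1 is enough. *)
    destruct HM as [HM|HM].
    + apply Rmult_le_reg_l with (/ M); [now apply Rinv_0_lt_compat|].
      replace (/ M * (M * phi t)) with (phi t) by (field; lra).
      apply Hphi. intros e [He0 He].
      apply Rmult_le_reg_l with M; auto. rewrite <- Rmult_assoc, Rinv_r, Rmult_1_l by lra.
      specialize (He i Hi u w T x y t Hadm Hsol Ht (Rle_refl t) Hz). fold M in He. lra.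
    + destruct (Hatt i Hi) as [H1 _].
      specialize (H1 u w T x y t Hadm Hsol Ht ltac:(lra) Hz). fold M in H1. lra.
Qed.

End Decay.

(** * Uniform continuity on boxes *)

(** The neighbourhood filter of $\mathbb R^N$ pulled back to sequences; coordinates from [N] on are
    ignored. *)
Definition coord_nbhd (N : nat) (p : nat -> R) (P : (nat -> R) -> Prop) : Prop :=
  exists delta, 0 < delta /\ forall q, (forall i, (i < N)%nat -> Rabs (q i - p i) < delta) -> P q.

Lemma coord_nbhd_filter N p : Filter (coord_nbhd N p).
Proof.
  split.
  - exists 1. split; [lra|auto].
  - intros P Q (d1 & H1 & HP) (d2 & H2 & HQ). exists (Rmin d1 d2).
    split; [now apply Rmin_pos|]. pose proof (Rmin_l d1 d2). pose proof (Rmin_r d1 d2).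
    intros q Hq. split; [apply HP|apply HQ]; intros i Hi; specialize (Hq i Hi); lra.
  - intros P Q HPQ (d1 & H1 & HP). exists d1. auto.
Qed.

Definition cont_coord (N : nat) (g : (nat -> R) -> R) : Prop :=
  forall p, cont_at (coord_nbhd N p) g p.

Lemma cont_coord_iff N g :
  cont_coord N g <-> forall p eps, 0 < eps -> exists delta, 0 < delta /\
    forall q, (forall i, (i < N)%nat -> Rabs (q i - p i) < delta) -> Rabs (g q - g p) < eps.
Proof.
  split; intros H p.
  - intros eps He. destruct (H p (fun r => Rabs (r - g p) < eps)) as (delta & Hd & Hq).
    { exists (mkposreal eps He). intros r Hr. exact Hr. }
    exists delta. auto.
  - intros P [eps HP]. destruct (H p eps (cond_pos eps)) as (delta & Hd & Hq).
    exists delta. split; auto. intros q Hq'. apply HP. now apply Hq.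
Qed.

Lemma cont_coord_proj N i : (i < N)%nat -> cont_coord N (fun p => p i).
Proof. intros Hi. apply cont_coord_iff. intros p eps He. exists eps. auto. Qed.

Lemma cont_coord_const N r : cont_coord N (fun _ => r).
Proof. intros p. apply cont_at_const, coord_nbhd_filter. Qed.

Lemma cont_coord_minus N f g : cont_coord N f -> cont_coord N g -> cont_coord N (fun p => f p - g p).
Proof. intros Hf Hg p. apply cont_at_minus; auto. apply coord_nbhd_filter. Qed.

Lemma cont_coord_mult N f g : cont_coord N f -> cont_coord N g -> cont_coord N (fun p => f p * g p).
Proof. intros Hf Hg p. apply cont_at_mult; auto. apply coord_nbhd_filter. Qed.

Lemma cont_coord_sum N m f : (forall j, (j < m)%nat -> cont_coord N (f j)) ->
  cont_coord N (fun p => sumR m (fun j => f j p)).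
Proof.
  intros Hf p. apply cont_at_sum; [apply coord_nbhd_filter|]. intros j Hj. now apply Hf.
Qed.

Lemma cont_coord_path N g (xi : R -> nat -> R) :
  cont_coord N g -> (forall i, (i < N)%nat -> continuity (fun s => xi s i)) ->
  continuity (fun s => g (xi s)).
Proof.
  intros Hg Hxi t. apply continuity_pt_filterlim. change (cont_at (locally t) (fun s => g (xi s)) t).
  intros P HP. specialize (Hg (xi t) P HP). destruct Hg as (delta & Hd & Hq).
  destruct (finite_delta N (fun i e => forall s, Rabs (s - t) < e -> Rabs (xi s i - xi t i) < delta))
    as (e & He & Hs).
  { intros i Hi. destruct (proj1 (cont_on_iff _ _ _) (cont_on_continuity (fun _ => True) _ t (Hxi i Hi)) delta Hd)
      as (e & He & Hs). exists e. split; auto. intros r Hr s Hst. apply Hs; auto. lra. }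
  exists (mkposreal e He). intros s Hst. apply Hq. intros i Hi. now apply Hs.
Qed.

(** Iterated pairs are the form in which compactness of boxes, [compactness_value], is stated. *)
Fixpoint to_tuple (N : nat) (p : nat -> R) : Compactness.Tn N R :=
  match N with
  | O => tt
  | S m => (p O, to_tuple m (fun i => p (S i)))
  end.

Fixpoint of_tuple (N : nat) : Compactness.Tn N R -> nat -> R :=
  match N with
  | O => fun _ _ => 0
  | S m => fun v i => match i with O => fst v | S i' => of_tuple m (snd v) i' end
  end.

Lemma bounded_to_tuple N lo hi p : (forall i, (i < N)%nat -> lo i <= p i <= hi i) ->
  bounded_n N (to_tuple N lo) (to_tuple N hi) (to_tuple N p).
Proof.
  revert lo hi p. induction N; simpl; intros lo hi p H; auto.
  split; [apply H; lia|]. apply IHN. intros i Hi. apply H. lia.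
Qed.

Lemma close_of_tuple N e p v : close_n N e (to_tuple N p) v ->
  forall i, (i < N)%nat -> Rabs (p i - of_tuple N v i) < e.
Proof.
  revert p. induction N; simpl; intros p H i Hi; [lia|]. destruct v as [v0 v]. destruct H as [H0 H].
  destruct i; simpl; auto. apply (IHN v (fun i => p (S i))); auto. lia.
Qed.

(* The gauge also carries the value bound [1 / (|g v| + 1)], so the single compactness
   argument yields boundedness together with uniform continuity. *)
Lemma box_uniform N g lo hi : cont_coord N g -> forall eps, 0 < eps ->
  exists delta, 0 < delta /\ forall p, (forall i, (i < N)%nat -> lo i <= p i <= hi i) ->
    Rabs (g p) <= / delta /\
    forall q, (forall i, (i < N)%nat -> Rabs (q i - p i) < delta) -> Rabs (g q - g p) < eps.
Proof.
  intros Hg eps He. rewrite cont_coord_iff in Hg.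
  (* The radius is [2 * delta] because [p] lies within the gauge of [v], and [q] within the smaller
     uniform [delta] of [p]. *)
  set (Ok := fun v (delta : posreal) => delta <= 1 / 2 /\ delta * (Rabs (g (of_tuple N v)) + 1) <= / 2 /\
    forall q, (forall i, (i < N)%nat -> Rabs (q i - of_tuple N v i) < 2 * delta) ->
      Rabs (g q - g (of_tuple N v)) < Rmin 1 (eps / 2)).
  assert (Hex : forall v, exists delta, Ok v delta).
  { intros v. destruct (Hg (of_tuple N v) (Rmin 1 (eps / 2))) as (delta & Hd & Hq).
    { apply Rmin_pos; lra. }
    set (M := Rabs (g (of_tuple N v)) + 1).
    assert (HM : 1 <= M) by (unfold M; pose proof (Rabs_pos (g (of_tuple N v))); lra).
    assert (HM' : 0 < / (2 * M)) by (apply Rinv_0_lt_compat; lra).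
    assert (Hr : 0 < Rmin (delta / 2) (/ (2 * M))) by (apply Rmin_pos; lra).
    exists (mkposreal _ Hr). unfold Ok; simpl. fold M.
    pose proof (Rmin_l (delta / 2) (/ (2 * M))). pose proof (Rmin_r (delta / 2) (/ (2 * M))).
    set (r := Rmin (delta / 2) (/ (2 * M))) in *.
    assert (r * M <= / 2).
    { apply Rle_trans with (/ (2 * M) * M); [apply Rmult_le_compat_r; lra|]. right. field. lra. }
    split; [nra|]. split; [lra|]. intros q Hq'. apply Hq. intros i Hi. specialize (Hq' i Hi). lra. }
  set (gauge := fun v => epsilon (inhabits (mkposreal 1 Rlt_0_1)) (Ok v)).
  assert (Hgauge : forall v, Ok v (gauge v)) by (intros v; apply epsilon_spec, Hex).
  destruct (compactness_value N (to_tuple N lo) (to_tuple N hi) gauge) as [delta Hdelta].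
  exists delta. split; [apply cond_pos|]. intros p Hp.
  specialize (Hdelta (to_tuple N p) (bounded_to_tuple N lo hi p Hp)).
  (* The compactness statement yields the covering point only under a double negation. *)
  apply NNPP in Hdelta. destruct Hdelta as (v & _ & Hclose & Hle).
  destruct (Hgauge v) as (H0 & H1 & H2). pose proof (close_of_tuple N _ p v Hclose) as Hpv.
  pose proof (cond_pos (gauge v)). pose proof (cond_pos delta).
  pose proof (Rmin_l 1 (eps / 2)). pose proof (Rmin_r 1 (eps / 2)).
  assert (Hgp : Rabs (g p - g (of_tuple N v)) < Rmin 1 (eps / 2)).
  { apply H2. intros i Hi. specialize (Hpv i Hi). lra. }
  split.
  - apply Rmult_le_reg_l with delta; auto. rewrite Rinv_r by lra.
    assert (Hab : Rabs (g p) <= Rabs (g (of_tuple N v)) + 1).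
    { replace (g p) with (g (of_tuple N v) + (g p - g (of_tuple N v))) by ring.
      eapply Rle_trans; [apply Rabs_triang|]. lra. }
    apply Rle_trans with (gauge v * (Rabs (g (of_tuple N v)) + 1)); [|lra].
    apply Rmult_le_compat; auto; [lra|apply Rabs_pos].
  - intros q Hq. replace (g q - g p) with ((g q - g (of_tuple N v)) - (g p - g (of_tuple N v))) by ring.
    eapply Rle_lt_trans; [apply Rabs_triang|]. rewrite Rabs_Ropp.
    enough (Rabs (g q - g (of_tuple N v)) < Rmin 1 (eps / 2)) by lra.
    apply H2. intros i Hi. specialize (Hpv i Hi). specialize (Hq i Hi).
    replace (q i - of_tuple N v i) with ((q i - p i) + (p i - of_tuple N v i)) by ring.
    eapply Rle_lt_trans; [apply Rabs_triang|]. lra.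
Qed.

Lemma continuity_glue f g t : continuity f -> continuity g -> f t = g t ->
  continuity (fun s => if Rle_dec s t then f s else g s).
Proof.
  intros Hf Hg Heq s. apply continuity_pt_filterlim.
  change (cont_at (locally s) (fun s => if Rle_dec s t then f s else g s) s).
  assert (Hloc : forall h, continuity h -> forall eps, 0 < eps -> exists delta, 0 < delta /\
    forall r, Rabs (r - s) < delta -> Rabs (h r - h s) < eps).
  { intros h Hh eps He.
    destruct (proj1 (cont_on_iff _ _ _) (cont_on_continuity (fun _ => True) h s Hh) eps He) as (e & He' & H).
    exists e. auto. }
  intros P [eps HP].
  destruct (Hloc f Hf eps (cond_pos eps)) as (d1 & Hd1 & H1).
  destruct (Hloc g Hg eps (cond_pos eps)) as (d2 & Hd2 & H2).
  (* Away from the junction, this radius keeps nearby points on the same side of [t] as [s]; at the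
     junction both pieces are controlled and any radius will do. *)
  set (d0 := if Req_dec_T s t then 1 else Rabs (s - t)).
  assert (Hd0 : 0 < d0).
  { unfold d0. destruct (Req_dec_T s t); [lra|]. apply Rabs_pos_lt. lra. }
  assert (Hd : 0 < Rmin d0 (Rmin d1 d2)) by (repeat apply Rmin_pos; auto).
  exists (mkposreal _ Hd). intros r Hr. change (Rabs (r - s) < Rmin d0 (Rmin d1 d2)) in Hr.
  pose proof (Rmin_l d0 (Rmin d1 d2)). pose proof (Rmin_r d0 (Rmin d1 d2)).
  pose proof (Rmin_l d1 d2). pose proof (Rmin_r d1 d2).
  specialize (H1 r ltac:(lra)). specialize (H2 r ltac:(lra)).
  apply HP. unfold d0 in *.
  match goal with |- ball ?y _ ?x => change (Rabs (x - y) < eps) end.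
  destruct (Req_dec_T s t) as [->|Hne].
  - destruct (Rle_dec t t); [|lra]. destruct (Rle_dec r t); auto. now rewrite Heq.
  - assert (Hsame : r <= t <-> s <= t).
    { assert (Rabs (r - s) < Rabs (s - t)) by lra. unfold Rabs in *. repeat destruct Rcase_abs; lra. }
    destruct (Rle_dec r t), (Rle_dec s t); auto; tauto.
Qed.

(** * Euler approximations with continuous error *)

(** With followers on the first axis and leaders at the origin, the system reduces to one scalar
    equation per follower. *)
Definition on_axis (xi : nat -> R) : State := fun i c => match c with O => xi i | S _ => 0 end.
Definition origin : State := fun _ _ => 0.
(** Time becomes coordinate 0, so uniform continuity on boxes treats time and state together. *)
Definition time_state (t : R) (xi : nat -> R) : nat -> R :=
  fun i => match i with O => t | S i' => xi i' end.

Section Euler.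
Variables (n k d : nat) (NF NL : R -> nat -> nat -> bool).
Variables (a b : nat -> nat -> State -> State -> R -> R) (alo ahi blo : R).
Hypothesis hw : weights_ok n k d a b alo ahi blo.
Variables (tauD : R) (sw : nat -> R).
Hypothesis htau : 0 < tauD.
Hypothesis hsw0 : sw O = 0.
Hypothesis hdwell : forall m, sw m + tauD <= sw (S m).
Hypothesis hpiece : forall m t, sw m <= t < sw (S m) ->
  (forall j i, NF t j i = NF (sw m) j i) /\ (forall j i, NL t j i = NL (sw m) j i).

(** [s] selects the topology and [t] is the time fed to the weights; they are separate so that the
    topology can be frozen at a switching instant. *)
Definition follower_gain (s : R) i (xi : nat -> R) t (f : nat -> R) : R :=
  sumR n (fun j => if NF s j i then a i j (on_axis xi) origin t * f j else 0).
Definition leader_gain (s : R) i (xi : nat -> R) t : R :=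
  sumR k (fun l => if NL s l i then b i l (on_axis xi) origin t else 0).
Definition axis_field (s : R) i (xi : nat -> R) t : R :=
  follower_gain s i xi t (fun j => xi j - xi i) - leader_gain s i xi t * xi i.

Definition in_box (xi : nat -> R) : Prop := forall i, (i < n)%nat -> Rabs (xi i) <= 2.

Lemma cont_axis_weight f : cont_xyt n k d f ->
  cont_coord (S n) (fun p => f (on_axis (fun i => p (S i))) origin (p O)).
Proof.
  intros Hf. apply cont_coord_iff. intros p eps He.
  destruct (Hf (on_axis (fun i => p (S i))) origin (p O) eps He) as (delta & Hd & H).
  exists delta. split; auto. intros q Hq. apply H.
  - intros i c Hi Hc. destruct c; simpl; [apply Hq; lia|]. now rewrite Rminus_diag, Rabs_R0.
  - intros i c Hi Hc. unfold origin. now rewrite Rminus_diag, Rabs_R0.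
  - apply Hq. lia.
Qed.

Lemma cont_axis_field s i : (i < n)%nat ->
  cont_coord (S n) (fun p => axis_field s i (fun j => p (S j)) (p O)).
Proof.
  intros Hi. destruct hw as (_ & _ & _ & Ha & Hb). unfold axis_field, follower_gain, leader_gain.
  apply cont_coord_minus; [|apply cont_coord_mult].
  - apply cont_coord_sum. intros j Hj. destruct (NF s j i); [|apply cont_coord_const].
    apply cont_coord_mult; [now apply cont_axis_weight, Ha|].
    apply cont_coord_minus; apply cont_coord_proj; lia.
  - apply cont_coord_sum. intros j Hj. destruct (NL s j i); [|apply cont_coord_const].
    now apply cont_axis_weight, Hb.
  - apply cont_coord_proj; lia.
Qed.

Definition box_lo (i : nat) : R := match i with O => 0 | S _ => -2 end.
Definition box_hi (T : R) (i : nat) : R := match i with O => T | S _ => 2 end.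

Lemma in_box_time_state T xi t : in_box xi -> 0 <= t <= T ->
  forall i, (i < S n)%nat -> box_lo i <= time_state t xi i <= box_hi T i.
Proof.
  intros Hb Ht [|i] Hi; simpl; auto. apply Rabs_le_between, Hb. lia.
Qed.

(** Leader weights have no global upper bound, but they are continuous, hence bounded on the compact
    set of box states and times. Summing over all leaders dominates the gain under every
    topology. *)
Lemma leader_gain_bound T : exists B, 0 <= B /\ forall i s xi t, (i < n)%nat -> in_box xi -> 0 <= t <= T ->
  0 <= leader_gain s i xi t <= B.
Proof.
  pose proof hw as (_ & _ & Hb0 & _ & Hb).
  assert (Hpos : forall i l xi t, (i < n)%nat -> (l < k)%nat -> 0 <= b i l (on_axis xi) origin t).
  { intros i l xi t Hi Hl. destruct (Hb i l Hi Hl) as [_ H]. specialize (H (on_axis xi) origin t). lra. }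
  set (g := fun i (p : nat -> R) => sumR k (fun l => b i l (on_axis (fun i => p (S i))) origin (p O))).
  destruct (finite_threshold n (fun i B => forall xi t, in_box xi -> 0 <= t <= T ->
     g i (time_state t xi) <= B)) as (B & HB0 & HB).
  { intros i Hi. destruct (box_uniform (S n) (g i) box_lo (box_hi T)) with (eps := 1) as (delta & Hd & H); [|lra|].
    - apply cont_coord_sum. intros l Hl. now apply cont_axis_weight, Hb.
    - exists (/ delta). intros r Hr xi t Hxi Ht.
      destruct (H _ (in_box_time_state T xi t Hxi Ht)) as [H1 _].
      eapply Rle_trans; [apply Rle_abs|]. lra. }
  exists B. split; auto. intros i s xi t Hi Hxi Ht. split.
  - apply sumR_ge0. intros l Hl. destruct (NL s l i); [now apply Hpos|lra].
  - eapply Rle_trans; [|apply (HB i Hi B (Rle_refl _) xi t Hxi Ht)].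
    apply sumR_le. intros l Hl. destruct (NL s l i); simpl; [apply Rle_refl|now apply Hpos].
Qed.

Lemma follower_gain_bound i s xi t : (i < n)%nat ->
  0 <= follower_gain s i xi t (fun _ => 1) <= INR n * ahi.
Proof.
  intros Hi. destruct hw as (Ha0 & Hah & _ & Ha & _). split.
  - apply sumR_ge0. intros j Hj. destruct (NF s j i); [|lra].
    destruct (Ha i j Hi Hj) as [_ H]. specialize (H (on_axis xi) origin t). lra.
  - rewrite <- sumR_const. apply sumR_le. intros j Hj. destruct (NF s j i); [|lra].
    destruct (Ha i j Hi Hj) as [_ H]. specialize (H (on_axis xi) origin t). lra.
Qed.

Lemma follower_gain_le i s xi t f m : (i < n)%nat ->
  (forall j, (j < n)%nat -> NF s j i = true -> f j <= m) ->
  follower_gain s i xi t f <= follower_gain s i xi t (fun _ => 1) * m.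
Proof.
  intros Hi Hf. destruct hw as (Ha0 & Hah & _ & Ha & _).
  unfold follower_gain. rewrite Rmult_comm, <- sumR_scal. apply sumR_le. intros j Hj.
  destruct (NF s j i) eqn:E; [|lra].
  destruct (Ha i j Hi Hj) as [_ H]. specialize (H (on_axis xi) origin t).
  rewrite Rmult_1_r, (Rmult_comm m). apply Rmult_le_compat_l; [lra|auto].
Qed.

Lemma follower_gain_ge i s xi t f m : (i < n)%nat ->
  (forall j, (j < n)%nat -> NF s j i = true -> m <= f j) ->
  follower_gain s i xi t (fun _ => 1) * m <= follower_gain s i xi t f.
Proof.
  intros Hi Hf. pose proof (follower_gain_le i s xi t (fun j => - f j) (- m) Hi) as H.
  replace (follower_gain s i xi t (fun j => - f j)) with (- follower_gain s i xi t f) in H.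
  - enough (- follower_gain s i xi t f <= follower_gain s i xi t (fun _ => 1) * - m) by lra.
    apply H. intros j Hj E. specialize (Hf j Hj E). lra.
  - unfold follower_gain. rewrite <- (Rmult_1_l (sumR n _)), Ropp_mult_distr_l, <- sumR_scal.
    apply sumR_ext. intros j _. destruct (NF s j i); ring.
Qed.

(** This form exhibits an Euler step as a combination with nonnegative coefficients when the step is
    small. *)
Lemma axis_field_split s i xi t :
  axis_field s i xi t = follower_gain s i xi t xi
    - (follower_gain s i xi t (fun _ => 1) + leader_gain s i xi t) * xi i.
Proof.
  unfold axis_field.
  enough (follower_gain s i xi t (fun j => xi j - xi i)
    = follower_gain s i xi t xi - xi i * follower_gain s i xi t (fun _ => 1)) by lra.
  unfold follower_gain. rewrite <- sumR_scal, <- sumR_minus. apply sumR_ext.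
  intros j _. destruct (NF s j i); ring.
Qed.

Lemma axis_field_uniform T Q eta : 0 < eta -> exists delta, 0 < delta /\
  forall q i xi t, (q < Q)%nat -> (i < n)%nat -> in_box xi -> 0 <= t <= T ->
    Rabs (axis_field (sw q) i xi t) <= / delta /\
    forall xi' t', (forall j, (j < n)%nat -> Rabs (xi' j - xi j) < delta) -> Rabs (t' - t) < delta ->
      Rabs (axis_field (sw q) i xi' t' - axis_field (sw q) i xi t) < eta.
Proof.
  intros Heta.
  set (P := fun q i delta => forall xi t, in_box xi -> 0 <= t <= T ->
    Rabs (axis_field (sw q) i xi t) <= / delta /\
    forall xi' t', (forall j, (j < n)%nat -> Rabs (xi' j - xi j) < delta) -> Rabs (t' - t) < delta ->
      Rabs (axis_field (sw q) i xi' t' - axis_field (sw q) i xi t) < eta).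
  assert (Hmono : forall q i r delta, 0 < r <= delta -> P q i delta -> P q i r).
  { intros q i r delta Hr HP xi t Hxi Ht. destruct (HP xi t Hxi Ht) as [H1 H2]. split.
    - eapply Rle_trans; [exact H1|]. apply Rinv_le_contravar; lra.
    - intros xi' t' Hj Ht'. apply H2; [|lra]. intros j Hj'. specialize (Hj j Hj'). lra. }
  destruct (finite_delta Q (fun q delta => forall i, (i < n)%nat -> P q i delta)) as (delta & Hd & H).
  - intros q Hq. destruct (finite_delta n (P q)) as (delta & Hd & H).
    + intros i Hi.
      destruct (box_uniform (S n) _ box_lo (box_hi T) (cont_axis_field (sw q) i Hi) eta Heta) as (delta & Hd & H).
      exists delta. split; auto. intros r Hr. apply Hmono with delta; auto. intros xi t Hxi Ht.
      destruct (H _ (in_box_time_state T xi t Hxi Ht)) as [H1 H2]. split; [exact H1|].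
      intros xi' t' Hj Ht'. apply (H2 (time_state t' xi')).
      intros [|j] Hj'; simpl; auto. apply Hj. lia.
    + exists delta. split; auto. intros r Hr i Hi. apply Hmono with delta; auto.
  - exists delta. split; auto. intros q i xi t Hq Hi Hxi Ht. now apply (H q Hq i Hi).
Qed.

(** From [t0] on, [Cl] is closed under in-neighbours and receives no leader arc. [B0] and [Bd] bound
    the leader gain up to [t0] and up to [T]; [c] is the decay rate allowed before [t0], [eps] the
    noise bound, [delta] a modulus of continuity of the field and [h0] the maximal Euler step. *)
Variables (t0 T eps c B0 Bd delta h0 : R) (q0 Q : nat) (Cl : nat -> Prop).
Hypothesis ht0 : t0 = sw q0.
Hypothesis hS : forall i, Cl i -> (i < n)%nat.
Hypothesis hSF : forall s j i, t0 <= s -> Cl i -> (j < n)%nat -> NF s j i = true -> Cl j.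
Hypothesis hSL : forall s l i, t0 <= s -> Cl i -> (l < k)%nat -> NL s l i = false.
Hypothesis hB0 : 0 <= B0 /\ forall i s xi t, (i < n)%nat -> in_box xi -> 0 <= t <= t0 -> 0 <= leader_gain s i xi t <= B0.
Hypothesis hBd : 0 <= Bd /\ forall i s xi t, (i < n)%nat -> in_box xi -> 0 <= t <= T -> 0 <= leader_gain s i xi t <= Bd.
Hypothesis hc : c = 2 * (B0 + 1).
Hypothesis heps : 0 < eps /\ eps * T <= 1 /\ eps <= exp (- c * t0).
Hypothesis hdelta : 0 < delta /\
  forall q i xi t, (q < Q)%nat -> (i < n)%nat -> in_box xi -> 0 <= t <= T ->
    Rabs (axis_field (sw q) i xi t) <= / delta /\
    forall xi' t', (forall j, (j < n)%nat -> Rabs (xi' j - xi j) < delta) -> Rabs (t' - t) < delta ->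
      Rabs (axis_field (sw q) i xi' t' - axis_field (sw q) i xi t) < eps / 2.
Hypothesis hh0 : 0 < h0 /\ h0 * (INR n * ahi + Bd) <= 1 /\ h0 * (B0 + 1) <= / 2 /\
  h0 < delta /\ h0 * (/ delta + eps) < delta.

(** [xi] solves the scalar system exactly up to time [t] with continuous noise [om]. [ap_end] leaves
    half of the noise budget for the discretisation error of the next step. The lower bound holds
    for all followers before [t0], afterwards only on [Cl]. *)
Record approx (t : R) (xi om : R -> nat -> R) : Prop := {
  ap_init : forall i, xi 0 i = 1;
  ap_cont : forall i, (i < n)%nat -> continuity (fun s => om s i);
  ap_noise : forall s i, (i < n)%nat -> Rabs (om s i) <= eps;
  ap_end : forall i, (i < n)%nat -> Rabs (om t i) <= eps / 2;
  ap_eq : forall i s, (i < n)%nat -> 0 <= s <= t ->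
    is_RInt (fun r => axis_field r i (xi r) r + om r i) 0 s (xi s i - xi 0 i);
  ap_upper : forall i s, (i < n)%nat -> 0 <= s <= t -> Rabs (xi s i) <= 1 + eps * s;
  ap_lower_early : forall i s, (i < n)%nat -> 0 <= s <= t -> s <= t0 -> exp (- c * s) <= xi s i;
  ap_lower_late : forall i s, Cl i -> 0 <= s <= t -> t0 <= s ->
    exp (- c * t0) - eps * (s - t0) <= xi s i }.

Lemma axis_field_same r s i xi t :
  (forall j i, NF r j i = NF s j i) -> (forall j i, NL r j i = NL s j i) ->
  axis_field r i xi t = axis_field s i xi t.
Proof.
  intros HF HL. unfold axis_field, follower_gain, leader_gain.
  f_equal; [|f_equal]; apply sumR_ext; intros j _; now rewrite ?HF, ?HL.
Qed.

(** It converts the loss factor of one Euler step into exponential decay, and explains the factor 2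
    in [c]. The proof rests on $(1+2x)(1-x)\ge 1$. *)
Lemma exp_neg_le x : 0 <= x <= / 2 -> exp (- (2 * x)) <= 1 - x.
Proof.
  intros Hx. rewrite exp_Ropp. pose proof (exp_ge_1p (2 * x)).
  apply Rmult_le_reg_l with (exp (2 * x)); [apply exp_pos|]. rewrite Rinv_r by (pose proof (exp_pos (2 * x)); lra).
  apply Rle_trans with ((1 + 2 * x) * (1 - x)); [nra|]. apply Rmult_le_compat_r; lra.
Qed.

(* [theta] is the time since the last node, [w] the noise there; the damped noise
   integrates to [w * kappa] with [0 <= kappa <= theta]. *)
Lemma euler_point_bounds q t t' xi om i w theta kappa :
  (q < Q)%nat -> sw q <= t -> t < t' <= sw (S q) -> 0 <= t -> t' <= T ->
  approx t xi om -> (i < n)%nat -> 0 <= theta <= h0 -> theta <= t' - t ->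
  0 <= kappa <= theta -> Rabs w <= eps ->
  let p := xi t i + theta * axis_field (sw q) i (xi t) t + w * kappa in
  Rabs (p - xi t i) < delta /\ Rabs p <= 1 + eps * (t + theta) /\
  (t + theta <= t0 -> exp (- c * (t + theta)) <= p) /\
  (Cl i -> t0 <= t -> exp (- c * t0) - eps * (t + theta - t0) <= p).
Proof.
  intros Hq Hqt Hqt' Ht HT Hap Hi Hth Hth' Hk Hw p.
  destruct heps as (He & HeT & Hec). destruct hh0 as (Hh & Hh1 & Hh2 & Hh3 & Hh4).
  destruct hdelta as (Hd & Hdf). destruct hBd as [HBd0 HBd]. destruct hB0 as [HB00 HB0'].
  assert (Hbox : in_box (xi t)).
  { intros j Hj. eapply Rle_trans; [apply (ap_upper _ _ _ Hap j t Hj); lra|].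
    assert (eps * t <= eps * T) by (apply Rmult_le_compat_l; lra). lra. }
  assert (Hwk : Rabs (w * kappa) <= eps * theta).
  { rewrite Rabs_mult, (Rabs_right kappa) by lra. apply Rmult_le_compat; try lra. apply Rabs_pos. }
  pose proof (proj1 (Rabs_le_between _ _) Hwk) as Hwk'.
  assert (Hepsth : 0 <= eps * theta) by (apply Rmult_le_pos; lra).
  set (A := follower_gain (sw q) i (xi t) t (fun _ => 1)).
  set (B := leader_gain (sw q) i (xi t) t).
  assert (HA : 0 <= A <= INR n * ahi) by now apply follower_gain_bound.
  assert (HB : 0 <= B <= Bd) by (apply HBd; auto; lra).
  assert (HAB : 0 <= theta * (A + B) <= 1).
  { split; [apply Rmult_le_pos; lra|]. apply Rle_trans with (h0 * (INR n * ahi + Bd)); auto.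
    apply Rmult_le_compat; lra. }
  assert (Hp : p = (1 - theta * (A + B)) * xi t i + theta * follower_gain (sw q) i (xi t) t (xi t) + w * kappa).
  { unfold p. rewrite axis_field_split. fold A B. ring. }
  assert (HthB : 0 <= theta * B) by (apply Rmult_le_pos; lra).
  (* A common lower bound of the follower and its in-neighbours survives the step up to leader
     attraction and noise. [m] may be negative, which also yields the lower half of the bound on
     [Rabs p]. *)
  assert (Hlow : forall m, m <= xi t i ->
     (forall j, (j < n)%nat -> NF (sw q) j i = true -> m <= xi t j) ->
     (1 - theta * B) * m - eps * theta <= p).
  { intros m Hmi Hmj. rewrite Hp.
    pose proof (follower_gain_ge i (sw q) (xi t) t (xi t) m Hi Hmj) as Hg. fold A in Hg.
    pose proof (Rmult_le_compat_l theta _ _ ltac:(lra) Hg).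
    pose proof (Rmult_le_compat_l (1 - theta * (A + B)) _ _ ltac:(lra) Hmi). lra. }
  split; [|split; [|split]].
  - unfold p. replace (_ + _ + _ - _) with (theta * axis_field (sw q) i (xi t) t + w * kappa) by ring.
    destruct (Hdf q i (xi t) t Hq Hi Hbox ltac:(lra)) as [Hf _].
    eapply Rle_lt_trans; [apply Rabs_triang|]. rewrite (Rabs_mult theta), (Rabs_right theta) by lra.
    pose proof (Rinv_0_lt_compat _ Hd).
    apply Rle_lt_trans with (h0 * (/ delta + eps)); auto.
    apply Rle_trans with (theta * (/ delta + eps)); [|apply Rmult_le_compat_r; lra].
    pose proof (Rmult_le_compat_l theta _ _ ltac:(lra) Hf). lra.
  - assert (Hm : forall j, (j < n)%nat -> - (1 + eps * t) <= xi t j <= 1 + eps * t).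
    { intros j Hj. apply Rabs_le_between. apply (ap_upper _ _ _ Hap j t Hj). lra. }
    assert (Hm0 : 0 <= theta * B * (1 + eps * t)).
    { apply Rmult_le_pos; auto. pose proof (Rmult_le_pos eps t). lra. }
    apply Rabs_le. split.
    + pose proof (Hlow (- (1 + eps * t)) ltac:(now apply Hm) ltac:(intros; now apply Hm)). lra.
    + rewrite Hp.
      pose proof (follower_gain_le i (sw q) (xi t) t (xi t) (1 + eps * t) Hi ltac:(intros; now apply Hm)) as Hg.
      fold A in Hg. pose proof (Rmult_le_compat_l theta _ _ ltac:(lra) Hg).
      pose proof (Rmult_le_compat_l (1 - theta * (A + B)) _ _ ltac:(lra) (proj2 (Hm i Hi))). lra.
  - intros Hearly. set (m := exp (- c * t)).
    assert (Hm : forall j, (j < n)%nat -> m <= xi t j).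
    { intros j Hj. apply (ap_lower_early _ _ _ Hap); auto; lra. }
    pose proof (Hlow m (Hm i Hi) (fun j Hj _ => Hm j Hj)) as Hl.
    assert (HBe : B <= B0) by (apply HB0'; auto; lra).
    assert (Hmpos : 0 < m) by apply exp_pos.
    (* As the noise is at most [m], noise and leader attraction together cost at most the fraction
       [theta * (B0 + 1)] of [m]. *)
    assert (Hme : eps <= m).
    { eapply Rle_trans; [exact Hec|]. unfold m.
      destruct (Req_dec t t0) as [->|Hne]; [lra|]. left. apply exp_increasing. rewrite hc. nra. }
    assert (Hth2 : theta * (B0 + 1) <= / 2).
    { apply Rle_trans with (h0 * (B0 + 1)); auto. apply Rmult_le_compat_r; lra. }
    pose proof (exp_neg_le (theta * (B0 + 1)) ltac:(split; [apply Rmult_le_pos; lra|auto])) as Hx.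
    replace (- c * (t + theta)) with (- c * t + - (2 * (theta * (B0 + 1)))) by (rewrite hc; ring).
    rewrite exp_plus. fold m.
    pose proof (Rmult_le_compat_l m _ _ ltac:(lra) Hx).
    pose proof (Rmult_le_compat_l theta _ _ ltac:(lra) Hme).
    pose proof (Rmult_le_compat_l (theta * m) _ _ ltac:(apply Rmult_le_pos; lra) HBe). lra.
  - intros HiS Hlate.
    assert (HB_0 : B = 0).
    { apply sumR_zero. intros l Hl.
      destruct (hpiece q t ltac:(lra)) as [_ E]. rewrite <- E.
      rewrite hSL; auto. }
    assert (Hm : forall j, Cl j -> exp (- c * t0) - eps * (t - t0) <= xi t j).
    { intros j Hj. apply (ap_lower_late _ _ _ Hap); auto; lra. }
    pose proof (Hlow (exp (- c * t0) - eps * (t - t0)) (Hm i HiS)) as Hl. rewrite HB_0 in Hl.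
    enough (exp (- c * t0) - eps * (t - t0) - eps * theta <= p) by lra.
    eapply Rle_trans; [|apply Hl]; [lra|]. intros j Hj E. apply Hm.
    destruct (hpiece q t ltac:(lra)) as [E' _]. rewrite <- E' in E.
    apply (hSF t j i); auto.
Qed.


(** On the new interval the curve [P] has derivative [f i] plus the old noise damped linearly to 0,
    and [W] is the noise making [P] an exact solution. It starts at [om t i], so [om] stays
    continuous, and ends as pure discretisation error below [eps / 2]. *)
Lemma euler_step q t t' xi om :
  (q < Q)%nat -> sw q <= t -> t < t' <= sw (S q) -> 0 <= t -> t' <= T -> t' - t <= h0 ->
  approx t xi om -> exists xi' om', approx t' xi' om'.
Proof.
  intros Hq Hqt Hqt' Ht HT Hlen Hap.
  pose proof heps as (He & HeT & Hec). pose proof hh0 as (Hh & Hh1 & Hh2 & Hh3 & Hh4).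
  pose proof hdelta as (Hd & Hdf).
  set (L := t' - t). assert (HL : 0 < L) by (unfold L; lra).
  set (f := fun i => axis_field (sw q) i (xi t) t).
  (* The primitive, vanishing at [t], of the damping factor [1 - (s - t) / L]. *)
  set (kappa := fun s => (s - t) - (s - t) * (s - t) / (2 * L)).
  set (P := fun s i => xi t i + (s - t) * f i + om t i * kappa s).
  set (W := fun s i => f i + om t i * (1 - (s - t) / L) - axis_field (sw q) i (P s) s).
  (* The constant extension makes the noise continuous and bounded on all of $\mathbb R$, as
     admissibility is required for all times. *)
  set (W' := fun s i => if Rle_dec s t' then W s i else W t' i).
  assert (HPt : forall i, P t i = xi t i) by (intros i; unfold P, kappa; field; lra).
  assert (Hk : forall s, t <= s <= t' -> 0 <= kappa s <= s - t).
  { intros s Hs. unfold kappa. replace ((s - t) * (s - t) / (2 * L)) with ((s - t) * ((s - t) / (2 * L))) by (field; lra).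
    assert (H0 : 0 <= (s - t) / (2 * L) <= 1).
    { split; [apply Rmult_le_pos; [lra|left; apply Rinv_0_lt_compat; lra]|].
      apply Rmult_le_reg_r with (2 * L); [lra|]. unfold Rdiv. rewrite Rmult_assoc, Rinv_l by lra. unfold L in *. lra. }
    nra. }
  assert (Hbox : in_box (xi t)).
  { intros j Hj. eapply Rle_trans; [apply (ap_upper _ _ _ Hap j t Hj); lra|].
    assert (eps * t <= eps * T) by (apply Rmult_le_compat_l; lra). lra. }
  assert (Hpt : forall s i, (i < n)%nat -> t <= s <= t' ->
    Rabs (P s i - xi t i) < delta /\ Rabs (P s i) <= 1 + eps * s /\
    (s <= t0 -> exp (- c * s) <= P s i) /\
    (Cl i -> t0 <= t -> exp (- c * t0) - eps * (s - t0) <= P s i)).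
  { intros s i Hi Hs.
    pose proof (euler_point_bounds q t t' xi om i (om t i) (s - t) (kappa s) Hq Hqt Hqt' Ht HT Hap Hi
      ltac:(lra) ltac:(lra) (Hk s Hs) (ap_noise _ _ _ Hap t i Hi)) as H. cbv zeta in H.
    replace (t + (s - t)) with s in H by ring. exact H. }
  assert (HW : forall s i, (i < n)%nat -> t <= s <= t' ->
    Rabs (W s i - om t i * (1 - (s - t) / L)) < eps / 2).
  { intros s i Hi Hs. unfold W.
    replace (_ - _ - _) with (- (axis_field (sw q) i (P s) s - f i)) by ring. rewrite Rabs_Ropp.
    apply Hdf; auto; [lra| |rewrite Rabs_right; lra]. intros j Hj. now apply Hpt. }
  assert (HWend : forall i, (i < n)%nat -> Rabs (W t' i) <= eps / 2).
  { intros i Hi. left. specialize (HW t' i Hi ltac:(lra)).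
    replace (1 - (t' - t) / L) with 0 in HW by (unfold L; field; unfold L in HL; lra).
    now rewrite Rmult_0_r, Rminus_0_r in HW. }
  assert (HWb : forall s i, (i < n)%nat -> t <= s <= t' -> Rabs (W s i) <= eps).
  { intros s i Hi Hs. specialize (HW s i Hi Hs). pose proof (ap_end _ _ _ Hap i Hi) as Hend.
    replace (W s i) with ((W s i - om t i * (1 - (s - t) / L)) + om t i * (1 - (s - t) / L)) by ring.
    eapply Rle_trans; [apply Rabs_triang|]. rewrite Rabs_mult.
    assert (H0 : 0 <= (s - t) / L <= 1).
    { split; [apply Rmult_le_pos; [lra|left; apply Rinv_0_lt_compat; lra]|].
      apply Rmult_le_reg_r with L; [lra|]. unfold Rdiv. rewrite Rmult_assoc, Rinv_l by lra. unfold L in *. lra. }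
    rewrite (Rabs_right (1 - (s - t) / L)) by lra.
    assert (Rabs (om t i) * (1 - (s - t) / L) <= eps / 2 * 1).
    { apply Rmult_le_compat; try lra. apply Rabs_pos. }
    lra. }
  assert (HWt : forall i, W t i = om t i).
  { intros i. unfold W. assert (Hfx : axis_field (sw q) i (P t) t = f i).
    { unfold f, axis_field, follower_gain, leader_gain.
      enough (HPx : P t = xi t) by now rewrite HPx.
      apply functional_extensionality. auto. }
    rewrite Hfx. field. lra. }
  assert (HPc : forall i, continuity (fun s => P s i)).
  { intros i. unfold P, kappa. reg. }
  assert (HWc : forall i, (i < n)%nat -> continuity (fun s => W s i)).
  { intros i Hi. unfold W. apply continuity_minus.
    - reg.
    - apply (cont_coord_path (S n) _ (fun s => time_state s (P s)) (cont_axis_field (sw q) i Hi)).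
      intros [|j] Hj; simpl; [reg|apply HPc]. }
  exists (fun s i => if Rle_dec s t then xi s i else P s i),
         (fun s i => if Rle_dec s t then om s i else W' s i).
  assert (Hold : forall (x y : R) s, s <= t -> (if Rle_dec s t then x else y) = x).
  { intros x y s Hs. destruct (Rle_dec s t); lra. }
  assert (Hnew : forall (x y : R) s, t < s -> (if Rle_dec s t then x else y) = y).
  { intros x y s Hs. destruct (Rle_dec s t); lra. }
  assert (HW'in : forall s i, s <= t' -> W' s i = W s i).
  { intros s i Hs. unfold W'. destruct (Rle_dec s t'); lra. }
  constructor.
  - intros i. rewrite Hold by lra. apply Hap.
  - intros i Hi. apply (continuity_glue (fun s => om s i) (fun s => W' s i)); [now apply Hap| |].
    + apply (continuity_glue (fun s => W s i) (fun _ => W t' i)); [now apply HWc| |auto].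
      apply continuity_const. now intros ? ?.
    + now rewrite HW'in, HWt by lra.
  - intros s i Hi. destruct (Rle_dec s t); [now apply Hap|]. unfold W'.
    destruct (Rle_dec s t'); apply HWb; auto; lra.
  - intros i Hi. rewrite Hnew, HW'in by lra. now apply HWend.
  - intros i s Hi Hs. rewrite (Hold _ _ 0) by lra.
    assert (Hfield : forall r x, t < r < t' -> axis_field r i x r = axis_field (sw q) i x r).
    { intros r x Hr. destruct (hpiece q r ltac:(lra)) as [E1 E2]. apply axis_field_same; auto. }
    assert (Hpast : forall s, 0 <= s <= t -> is_RInt (fun r => axis_field r i
        (fun j => if Rle_dec r t then xi r j else P r j) r + (if Rle_dec r t then om r i else W' r i))
        0 s (xi s i - xi 0 i)).
    { intros s' Hs'. apply is_RInt_ext with (fun r => axis_field r i (xi r) r + om r i); [|now apply Hap].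
      rewrite Rmin_left, Rmax_right by lra. intros r Hr.
      destruct (Rle_dec r t); [reflexivity|lra]. }
    destruct (Rle_dec s t) as [Hst|Hst]; [apply Hpast; lra|].
    replace (P s i - xi 0 i) with (plus (xi t i - xi 0 i) (P s i - P t i))
      by (rewrite HPt; unfold plus; simpl; ring).
    apply (is_RInt_Chasles (V := R_NormedModule) _ 0 t s); [apply Hpast; lra|].
    apply is_RInt_ext with (fun r => f i + om t i * (1 - (r - t) / L)).
    + rewrite Rmin_left, Rmax_right by lra. intros r Hr.
      destruct (Rle_dec r t); [lra|]. rewrite HW'in by lra.
      rewrite Hfield by lra.
      unfold W. change (fun j => P r j) with (P r). lra.
    + apply (is_RInt_derive (V := R_CompleteNormedModule) (fun s => P s i)).
      * intros r _. unfold P, kappa. auto_derive; [lra|]. field. lra.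
      * intros r _. apply continuity_pt_filterlim.
        assert (Hc : continuity (fun r => f i + om t i * (1 - (r - t) / L))) by reg. apply Hc.
  - intros i s Hi Hs. destruct (Rle_dec s t); [apply Hap; auto; lra|]. apply Hpt; auto; lra.
  - intros i s Hi Hs Hst0. destruct (Rle_dec s t); [apply Hap; auto; lra|]. apply Hpt; auto; lra.
  - intros i s Hi Hs Hst0. destruct (Rle_dec s t); [apply Hap; auto; lra|].
    (* If the piece ends by [t0], then [s] equals [t0] and the early bound applies. Otherwise the
       step starts at or after [t0]. *)
    destruct (Nat.le_gt_cases (S q) q0) as [Hle|Hgt].
    + pose proof (switch_le tauD sw htau hdwell (S q) q0 Hle).
      replace s with t0 by (rewrite ht0 in *; lra).
      rewrite Rminus_diag, Rmult_0_r, Rminus_0_r.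
      apply (Hpt t0 i (hS i Hi) ltac:(rewrite ht0 in *; lra)). lra.
    + pose proof (switch_le tauD sw htau hdwell q0 q ltac:(lia)).
      apply Hpt; auto; [lra|]. rewrite ht0. lra.
Qed.

(** Outer induction over the pieces, inner induction over the number of steps of length at most
    [h0]; no step crosses a switching instant. *)
Lemma approx_exists : 0 <= t0 -> T <= sw Q -> 0 <= T -> exists xi om, approx T xi om.
Proof.
  intros Ht0 HTQ HT.
  pose proof heps as (He & HeT & Hec). pose proof hh0 as (Hh & _).
  assert (Hbase : exists xi om, approx 0 xi om).
  { exists (fun _ _ => 1), (fun _ _ => 0). constructor.
    - auto.
    - intros. apply continuity_const. now intros ? ?.
    - intros. rewrite Rabs_R0. lra.
    - intros. rewrite Rabs_R0. lra.
    - intros i s Hi Hs. replace s with 0 by lra. rewrite Rminus_diag. apply (is_RInt_point (V := R_NormedModule)).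
    - intros i s Hi Hs. replace s with 0 by lra. rewrite Rabs_R1. lra.
    - intros i s Hi Hs _. replace s with 0 by lra. rewrite Rmult_0_r, exp_0. lra.
    - intros i s Hi Hs Hs0. replace t0 with 0 by lra. replace s with 0 by lra.
      rewrite Rmult_0_r, exp_0. lra. }
  enough (H : forall q, (q <= Q)%nat -> forall t, 0 <= t <= sw q -> t <= T -> exists xi om, approx t xi om)
    by (apply (H Q); auto; lra).
  induction q; intros HqQ t Ht HtT.
  - replace t with 0 by lra. exact Hbase.
  - pose proof (switch_le tauD sw htau hdwell 0 q (Nat.le_0_l q)) as Hsw0. rewrite hsw0 in Hsw0.
    destruct (Rle_lt_dec t (sw q)) as [Hle|Hlt]; [apply IHq; [lia|lra|lra]|].
    enough (Hin : forall N t, sw q <= t -> t <= sw (S q) -> t <= T -> t - sw q <= INR N * h0 ->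
      exists xi om, approx t xi om).
    { destruct (INR_unbounded ((t - sw q) / h0)) as [N HN]. apply (Hin N); try lra.
      replace (t - sw q) with ((t - sw q) / h0 * h0) by (field; lra). apply Rmult_le_compat_r; lra. }
    clear t Ht HtT Hlt. induction N; intros t H1 H2 H3 H4.
    + simpl in H4. apply IHq; auto; [lia|lra].
    + rewrite S_INR in H4. destruct (Req_dec t (sw q)) as [->|Hne]; [apply IHq; [lia|lra|lra]|].
      (* The previous node lies at distance at most [h0] and not before the start of the piece. *)
      set (s := Rmax (sw q) (t - h0)).
      assert (Hs : sw q <= s < t /\ t - h0 <= s) by (unfold s, Rmax; destruct Rle_dec; lra).
      assert (Hs' : s = sw q \/ s = t - h0) by (unfold s, Rmax; destruct Rle_dec; lra).
      destruct (IHN s) as (xi & om & Hap); try lra.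
      { pose proof (pos_INR N). pose proof (Rmult_le_pos (INR N) h0). destruct Hs'; lra. }
      apply (euler_step q s t xi om); auto; try lra; lia.
Qed.

End Euler.

(** * SiISS implies JLC *)

Lemma hull_dist_origin k d v : (1 <= k)%nat -> hull_dist k d origin v = norm_d d v.
Proof.
  intros hk. destruct (hull_dist_inf k d hk origin v) as [H1 H2].
  assert (Hp : forall p, in_hull k d origin p ->
    norm_d d (fun c => v c - p c) = norm_d d v).
  { intros p (lam & _ & _ & Hp). apply norm_ext. intros c Hc. rewrite Hp by auto.
    rewrite sumR_zero; [ring|]. intros j _. unfold origin. ring. }
  apply Rle_antisym.
  - apply H1. destruct (near_vertex k d origin 0) as (mu & Hm1 & Hm2 & _); [lia|].
    set (p := fun c => sumR k (fun j => mu j * origin j c)).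
    assert (HpH : in_hull k d origin p) by (exists mu; auto).
    exists p. split; auto. symmetry. now apply Hp.
  - apply H2. intros s (p & HpH & ->). right. symmetry. now apply Hp.
Qed.

Lemma sum_sq_on_axis d xi i : (1 <= d)%nat ->
  sumR d (fun c => (on_axis xi i c)^2) = xi i ^ 2.
Proof.
  destruct d as [|d]; [lia|]. intros _. induction d as [|d IH].
  - simpl. ring.
  - change (sumR (S d) (fun c => (on_axis xi i c)^2) + 0 ^ 2 = xi i ^ 2). rewrite IH. ring.
Qed.

Lemma norm_on_axis d xi i : (1 <= d)%nat -> norm_d d (on_axis xi i) = Rabs (xi i).
Proof.
  intros hd. unfold norm_d. rewrite sum_sq_on_axis by auto.
  rewrite <- Rsqr_pow2. apply sqrt_Rsqr_abs.
Qed.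

Lemma cont_sqrt_comp f : continuity f -> continuity (fun s => sqrt (f s)).
Proof.
  intros Hf t. apply continuity_pt_filterlim.
  apply (continuous_comp f sqrt t).
  - apply continuity_pt_filterlim. apply Hf.
  - apply continuous_sqrt.
Qed.

Lemma continuity_sum m (f : nat -> R -> R) :
  (forall j, (j < m)%nat -> continuity (f j)) -> continuity (fun s => sumR m (fun j => f j s)).
Proof.
  induction m; simpl; intros H; [apply continuity_const; now intros ? ?|].
  apply (continuity_plus (fun s => sumR m (fun j => f j s)) (f m)); [apply IHm; intros|]; apply H; lia.
Qed.

Section Necessity.
Variables (n k d : nat) (NF NL : R -> nat -> nat -> bool).
Variables (a b : nat -> nat -> State -> State -> R -> R) (alo ahi blo : R).
Hypothesis hk : (1 <= k)%nat.
Hypothesis hd : (1 <= d)%nat.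
Hypothesis hw : weights_ok n k d a b alo ahi blo.

Section AxisSolution.
Variables (T : R) (xi om : R -> nat -> R).
Hypothesis hcont : forall i, (i < n)%nat -> continuity (fun s => om s i).
Hypothesis heq : forall i s, (i < n)%nat -> 0 <= s <= T ->
  is_RInt (fun r => axis_field n k NF NL a b r i (xi r) r + om r i) 0 s (xi s i - xi 0 i).

Definition no_input : nat -> State -> R -> Vec := fun _ _ _ _ => 0.
Definition axis_noise : nat -> R -> Vec := fun i s => on_axis (om s) i.

Lemma axis_admissible : admissible n k d no_input axis_noise.
Proof.
  split; [|split].
  - intros l t Hl y eps He. exists 1. split; [lra|]. intros. unfold no_input.
    now rewrite Rminus_diag, Rabs_R0.
  - intros l y c Hl Hc lo hi Hlh. exists 1%nat, (fun j => match j with O => lo | S _ => hi end).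
    repeat split; auto.
    + intros j Hj. replace j with O by lia. auto.
    + intros j Hj. exists (fun _ => 0). split; auto. apply continuity_const. now intros ? ?.
  - intros i c Hi Hc. destruct c; simpl; [now apply hcont|]. apply continuity_const. now intros ? ?.
Qed.

Lemma axis_rhs s i c : rhsF n k NF NL a b axis_noise (fun s => on_axis (xi s)) (fun _ => origin) s i c
  = match c with O => axis_field n k NF NL a b s i (xi s) s + om s i | S _ => 0 end.
Proof.
  unfold rhsF, axis_noise. destruct c; simpl.
  - f_equal. unfold axis_field, follower_gain, leader_gain, origin.
    rewrite <- (Rmult_1_l (sumR k (fun l => if NL s l i then b i l _ _ s else 0))).
    replace (1 * sumR k (fun l => if NL s l i then b i l (on_axis (xi s)) (fun _ _ => 0) s else 0) * xi s i)
      with (- (- xi s i * sumR k (fun l => if NL s l i then b i l (on_axis (xi s)) (fun _ _ => 0) s else 0))) by ring.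
    rewrite <- sumR_scal. unfold Rminus at 3. rewrite Ropp_involutive. f_equal.
    apply sumR_ext. intros j _. destruct (NL s j i); ring.
  - rewrite !sumR_zero; [ring| |]; intros j _; unfold origin.
    + destruct (NL s j i); ring.
    + destruct (NF s j i); ring.
Qed.

Lemma axis_solves : solves n k d NF NL a b no_input axis_noise T
  (fun s => on_axis (xi s)) (fun _ => origin).
Proof.
  assert (Hconv : forall f t g0 gt, is_RInt f 0 t (gt - g0) ->
    exists pr : Riemann_integrable f 0 t, gt = g0 + RiemannInt pr).
  { intros f t g0 gt H. exists (ex_RInt_Reals_0 f 0 t (ex_intro _ _ H)).
    rewrite <- RInt_Reals. pose proof (is_RInt_unique f 0 t _ H) as HU.
    unfold Rminus in HU. rewrite HU. ring. }
  intros t Ht. split.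
  - intros l c Hl Hc. apply Hconv. apply (is_RInt_cst 0 t 0). unfold origin. ring.
  - intros i c Hi Hc. apply Hconv. destruct c.
    + apply is_RInt_ext with (fun r => axis_field n k NF NL a b r i (xi r) r + om r i).
      * intros s _. now rewrite axis_rhs.
      * apply heq; auto. lra.
    + apply is_RInt_ext with (fun _ => 0); [intros s _; now rewrite axis_rhs|].
      apply is_RInt_cst. simpl. ring.
Qed.

Lemma axis_znorm s : znorm n k d no_input axis_noise (fun _ => origin) s = norm_d n (om s).
Proof.
  unfold znorm, norm_d. f_equal.
  rewrite sumR_zero, Rplus_0_l.
  - apply sumR_ext. intros i _. now apply sum_sq_on_axis.
  - intros l _. apply sumR_zero. intros c _. unfold no_input. ring.
Qed.

End AxisSolution.

Variables (tauD : R) (sw : nat -> R).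
Hypothesis htau : 0 < tauD.
Hypothesis hsw0 : sw O = 0.
Hypothesis hdwell : forall m, sw m + tauD <= sw (S m).
Hypothesis hpiece : forall m t, sw m <= t < sw (S m) ->
  (forall j i, NF t j i = NF (sw m) j i) /\ (forall j i, NL t j i = NL (sw m) j i).

(** [D] is fixed before the horizon [T] and the noise level [e], so both can later be adapted to the
    given $\beta$ and $\gamma$. *)
Lemma persistent_distance q0 i0 : (i0 < n)%nat ->
  (forall l j, (l < k)%nat -> (j < n)%nat -> clos_refl_trans nat (joint_F n NF (sw q0)) j i0 ->
     forall s, sw q0 <= s -> NL s l j = false) ->
  exists D, 0 < D <= 1 /\ forall T e, sw q0 <= T -> 0 < e -> exists xi om,
    (forall i, xi 0 i = 1) /\ (forall i, (i < n)%nat -> continuity (fun s => om s i)) /\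
    (forall s i, (i < n)%nat -> Rabs (om s i) <= e) /\
    (forall i s, (i < n)%nat -> 0 <= s <= T ->
       is_RInt (fun r => axis_field n k NF NL a b r i (xi r) r + om r i) 0 s (xi s i - xi 0 i)) /\
    forall s, sw q0 <= s <= T -> D - e * (s - sw q0) <= xi s i0.
Proof.
  intros Hi0 Hun. set (t0 := sw q0) in *.
  assert (Ht0 : 0 <= t0).
  { rewrite <- hsw0. apply (switch_le tauD sw htau hdwell). lia. }
  set (Cl := fun j => (j < n)%nat /\ clos_refl_trans nat (joint_F n NF t0) j i0).
  destruct (leader_gain_bound n k d NL a b alo ahi blo hw t0) as (B0 & HB0 & HB0').
  set (c := 2 * (B0 + 1)). exists (exp (- c * t0)).
  assert (HD : 0 < exp (- c * t0) <= 1).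
  { split; [apply exp_pos|]. rewrite <- exp_0.
    assert (Hct : 0 <= c * t0) by (apply Rmult_le_pos; unfold c; lra).
    destruct Hct as [Hct|Hct]; [left; apply exp_increasing; lra|right; f_equal; lra]. }
  split; auto. intros T e0 HT He0.
  set (e := Rmin e0 (Rmin (/ (T + 1)) (exp (- c * t0)))).
  assert (HTi : 0 < / (T + 1)) by (apply Rinv_0_lt_compat; lra).
  assert (He : 0 < e) by (repeat apply Rmin_pos; lra).
  pose proof (Rmin_l e0 (Rmin (/ (T + 1)) (exp (- c * t0)))) as He1.
  pose proof (Rmin_r e0 (Rmin (/ (T + 1)) (exp (- c * t0)))) as He2.
  pose proof (Rmin_l (/ (T + 1)) (exp (- c * t0))). pose proof (Rmin_r (/ (T + 1)) (exp (- c * t0))).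
  fold e in He1, He2.
  assert (HeT : e * T <= 1).
  { apply Rle_trans with (/ (T + 1) * (T + 1)); [apply Rmult_le_compat; lra|]. rewrite Rinv_l; lra. }
  destruct (switch_beyond tauD sw htau hsw0 hdwell T) as [Q HQ].
  destruct (leader_gain_bound n k d NL a b alo ahi blo hw T) as (Bd & HBd & HBd').
  destruct (axis_field_uniform n k d NF NL a b alo ahi blo hw sw T Q (e / 2) ltac:(lra)) as (delta & Hd & Hdf).
  pose proof hw as (Ha0 & Hah & _).
  set (G := INR n * ahi + Bd).
  assert (HG : 0 <= G).
  { apply Rplus_le_le_0_compat; auto. apply Rmult_le_pos; [apply pos_INR|lra]. }
  pose proof (Rinv_0_lt_compat _ Hd) as Hdi.
  (* Each summand enforces one restriction on the step size [/ M]; the factors 2 in the last two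
     make those inequalities strict. *)
  set (M := G + 2 * (B0 + 1) + 2 / delta + 2 * (/ delta + e) / delta).
  assert (HM1 : 0 < 2 / delta) by (apply Rdiv_lt_0_compat; lra).
  assert (HM2 : 0 < 2 * (/ delta + e) / delta) by (apply Rdiv_lt_0_compat; lra).
  assert (HM : 0 < M) by (unfold M; lra).
  assert (Hh : forall r s, 0 <= r -> r <= s * M -> / M * r <= s).
  { intros r s Hr Hrs. apply Rmult_le_reg_l with M; auto. rewrite <- Rmult_assoc, Rinv_r by lra. lra. }
  assert (Hh0 : 0 < / M /\ / M * G <= 1 /\ / M * (B0 + 1) <= / 2 /\ / M < delta /\ / M * (/ delta + e) < delta).
  { split; [now apply Rinv_0_lt_compat|]. split; [apply Hh; [lra|unfold M; lra]|].
    split; [apply Hh; [lra|unfold M; lra]|].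
    assert (HX : forall r, 0 <= r -> 2 * r / delta <= M -> r <= delta / 2 * M).
    { intros r Hr HrM. apply Rle_trans with (delta / 2 * (2 * r / delta)); [right; field; lra|].
      apply Rmult_le_compat_l; lra. }
    split.
    - apply Rle_lt_trans with (delta / 2); [|lra]. rewrite <- (Rmult_1_r (/ M)). apply Hh; [lra|].
      apply HX; [lra|]. replace (2 * 1 / delta) with (2 / delta) by (field; lra). unfold M. lra.
    - apply Rle_lt_trans with (delta / 2); [|lra]. apply Hh; [lra|]. apply HX; [lra|]. unfold M. lra. }
  destruct (approx_exists n k d NF NL a b alo ahi blo hw tauD sw htau hsw0 hdwell hpiece
    t0 T e c B0 Bd delta (/ M) q0 Q Cl) as (xi & om & Hap); auto; try lra.
  - intros i [Hi _]; auto.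
  - intros s j i Hs [Hi Hpath] Hj E. split; auto. apply rt_trans with i; auto. apply rt_step.
    split; auto. split; auto. now exists s.
  - intros s l i Hs [Hi Hpath] Hl. now apply Hun.
  - exists xi, om. split; [apply Hap|]. split; [apply Hap|]. split; [|split; [apply Hap|]].
    + intros s i Hi. eapply Rle_trans; [now apply Hap|lra].
    + intros s Hs. apply Rle_trans with (exp (- c * t0) - e * (s - t0)).
      * apply Rplus_le_compat_l, Ropp_le_contravar, Rmult_le_compat_r; lra.
      * apply (ap_lower_late _ _ _ _ _ _ _ _ _ _ _ _ _ Hap); try lra.
        split; auto. apply rt_refl.
Qed.

Lemma classK_ge0 g r : classK g -> 0 <= r -> 0 <= g r.
Proof.
  intros (H0 & _ & Hincr) [Hr|<-]; [|rewrite H0; lra].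
  rewrite <- H0. left. apply Hincr; lra.
Qed.

Lemma classK_le g r s : classK g -> 0 <= r <= s -> g r <= g s.
Proof.
  intros (_ & _ & Hincr) [Hr [Hrs| ->]]; [left; now apply Hincr|lra].
Qed.

(** For an unreachable follower, at a late time [tE] the distance is still at least [3 * D / 4],
    while $\beta$ contributes less than [D / 4] and the integral at most [D / 4]. *)
Theorem SiISS_JLC : SiISS n k d NF NL a b -> JLC n k NF NL.
Proof.
  intros (beta & gamma & (HbK & HbL) & HgK & Hiss) tt Htt i0 Hi0.
  apply NNPP. intros Hno.
  (* Passing to a later switching instant only removes arcs from the joint graph, so the follower
     remains unreachable. *)
  destruct (switch_beyond tauD sw htau hsw0 hdwell tt) as [q0 Hq0].
  set (t0 := sw q0) in *.
  assert (Hweak : forall j i, clos_refl_trans nat (joint_F n NF t0) j i ->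
    clos_refl_trans nat (joint_F n NF tt) j i).
  { induction 1 as [j i (Hj & Hi & s & Hs & E)| |]; [|apply rt_refl|eapply rt_trans; eauto].
    apply rt_step. split; auto. split; auto. exists s. split; auto. lra. }
  destruct (persistent_distance q0 i0 Hi0) as (D & HD & Hsol).
  { intros l j Hl Hj Hpath s Hs. destruct (NL s l j) eqn:E; auto. exfalso. apply Hno.
    exists l, j. split; auto. split; auto. split; [exists s; split; auto; unfold t0 in Hq0; lra|].
    now apply Hweak. }
  fold t0 in Hsol.
  destruct (HbL 1 ltac:(lra)) as [_ HbT]. destruct (HbT (D / 4) ltac:(lra)) as [T1 HT1].
  set (tE := Rmax T1 t0). pose proof (Rmax_l T1 t0) as HE1. pose proof (Rmax_r T1 t0) as HE2.
  fold tE in HE1, HE2.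
  (* Solutions live on $[0,T)$, so [tE] must lie strictly inside. *)
  set (T := tE + 1).
  set (Dg := D / (4 * T)). assert (HDg : 0 < Dg) by (apply Rdiv_lt_0_compat; unfold T; lra).
  pose proof HgK as (Hg0 & Hgc & Hgi).
  destruct (Hgc 0 Dg ltac:(lra) HDg) as (dg & Hdg & Hgd).
  (* The second bound gives $|z|\le n e<$ [dg], hence $\gamma(|z|)\le$ [Dg]; the first limits the
     drift of the lower bound to [D / 4]. *)
  set (e := Rmin Dg (dg / (INR n + 1))).
  assert (Hn0 : 0 <= INR n) by apply pos_INR.
  assert (He : 0 < e) by (apply Rmin_pos; auto; apply Rdiv_lt_0_compat; lra).
  assert (He1 : e <= Dg) by apply Rmin_l.
  assert (He2 : INR n * e < dg).
  { apply Rlt_le_trans with ((INR n + 1) * e); [lra|].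
    apply Rle_trans with ((INR n + 1) * (dg / (INR n + 1))); [apply Rmult_le_compat_l; [lra|apply Rmin_r]|].
    right. field. lra. }
  destruct (Hsol T e ltac:(unfold T; lra) He) as (xi & om & Hinit & Hcont & Hom & Heq & Hlow).
  set (x := fun s => on_axis (xi s)). set (y := fun _ : R => origin).
  set (z := znorm n k d no_input (axis_noise om) y).
  assert (Hz : forall s, z s = norm_d n (om s)) by (intros s; apply axis_znorm).
  assert (Hz0 : forall s, 0 <= z s) by (intros s; apply sqrt_pos).
  assert (Hzb : forall s, z s <= INR n * e).
  { intros s. rewrite Hz. eapply Rle_trans; [apply norm_le_sum|]. rewrite <- sumR_const.
    apply sumR_le. intros; now apply Hom. }
  assert (Hgz : forall s, 0 <= gamma (z s) <= Dg).
  { intros s. pose proof (classK_ge0 gamma (z s) HgK (Hz0 s)). split; auto.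
    specialize (Hgd (z s) (Hz0 s)). rewrite Rminus_0_r, (Rabs_right (z s)) in Hgd by (apply Rle_ge, Hz0).
    specialize (Hzb s). specialize (Hgd ltac:(lra)). rewrite Hg0, Rminus_0_r in Hgd.
    apply Rabs_def2 in Hgd. lra. }
  assert (Hzc : continuity z).
  { assert (HC : continuity (fun s => sqrt (sumR n (fun i => (om s i)^2)))).
    { apply cont_sqrt_comp, continuity_sum. intros j Hj. simpl.
      apply (continuity_mult (fun s => om s j) (fun s => om s j * 1)); [now apply Hcont|].
      apply (continuity_mult (fun s => om s j)); [now apply Hcont|]. apply continuity_const. now intros ? ?. }
    intros t. apply continuity_pt_ext with (2 := HC t). intros s. symmetry. apply Hz. }
  assert (Hex : ex_RInt (fun s => gamma (z s)) 0 tE).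
  { apply (ex_RInt_continuous (V := R_CompleteNormedModule)). intros t _.
    intros P [eps HP]. destruct (Hgc (z t) eps (Hz0 t) (cond_pos eps)) as (d1 & Hd1 & H1).
    destruct (proj1 (cont_on_iff (fun _ => True) _ _) (cont_on_continuity _ z t Hzc) d1 Hd1) as (d2 & Hd2 & H2).
    exists (mkposreal d2 Hd2). intros s Hs. apply HP. apply H1; auto. }
  pose proof (Hiss no_input (axis_noise om) (axis_admissible om Hcont) T x y ltac:(unfold T; lra)
    (axis_solves T xi om Heq) tE ltac:(unfold T; lra) (ex_RInt_Reals_0 _ _ _ Hex)) as Hfin.
  rewrite <- RInt_Reals in Hfin.
  change (RInt _ 0 tE) with (RInt (fun s => gamma (z s)) 0 tE) in Hfin.
  assert (Hint : RInt (fun s => gamma (z s)) 0 tE <= tE * Dg).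
  { apply (is_RInt_le (fun s => gamma (z s)) (fun _ => Dg) 0 tE); [lra| |apply is_RInt_cst; ring|].
    - apply (RInt_correct (V := R_CompleteNormedModule)), Hex.
    - intros s _. apply Hgz. }
  assert (Hdist0 : 0 <= dist_max n k d (y 0) (x 0) <= 1).
  { split; [apply dist_max_ge0|]. apply dist_max_le; [lra|]. intros i Hi. unfold x, y.
    rewrite hull_dist_origin, norm_on_axis, Hinit, Rabs_R1 by auto. lra. }
  assert (Hbeta : beta (dist_max n k d (y 0) (x 0)) tE <= beta 1 tE)
    by (apply (classK_le (fun r => beta r tE)); auto; apply HbK; lra).
  specialize (HT1 tE HE1).
  assert (HdistE : D - e * (tE - t0) <= dist_max n k d (y tE) (x tE)).
  { eapply Rle_trans; [apply (Hlow tE); unfold T; lra|].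
    eapply Rle_trans; [|apply (dist_max_ge n k d (y tE) (x tE) i0 Hi0)]. unfold x, y.
    rewrite hull_dist_origin, norm_on_axis by auto. apply Rle_abs. }
  assert (HTD : T * Dg = D / 4) by (unfold Dg; field; unfold T; lra).
  assert (H1 : tE * Dg <= T * Dg) by (apply Rmult_le_compat_r; unfold T; lra).
  assert (H2 : e * (tE - t0) <= T * Dg).
  { rewrite Rmult_comm. apply Rmult_le_compat; unfold T; lra. }
  lra.
Qed.

End Necessity.

Theorem theorem4 (n k d : nat) (hn : (2 <= n)%nat) (hk : (1 <= k)%nat) (hd : (1 <= d)%nat)
  (NF NL : R -> nat -> nat -> bool) (hsw : dwell_switching NF NL)
  (a b : nat -> nat -> State -> State -> R -> R) (alo ahi blo : R)
  (hw : weights_ok n k d a b alo ahi blo)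
  (hacyc : joint_follower_acyclic n NF) :
  SiISS n k d NF NL a b <-> JLC n k NF NL.
Proof.
  destruct hsw as (tauD & htau & sw & hsw0 & hdwell & hpiece). split.
  - now apply (SiISS_JLC n k d NF NL a b alo ahi blo hk hd hw tauD sw).
  - now apply (JLC_SiISS n k d NF NL a b alo ahi blo hk hw tauD sw).
Qed.
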